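(* Let $g\in\mathbb C\setminus\{0\}$ and $m\in\mathbb C$. Then there is an exact sequence of $W_L$-modules $$0\to W_L((m+g)\beta^\circ)\hookrightarrow W_L(m\beta^\circ)\xrightarrow{\ e^{\beta^\circ}(-g^{-1}m-1)\circ\varepsilon\ }W_L((m+1)\beta^\circ)\to0,$$ where the first map is the natural inclusion inside $V_{\mathfrak h}$.
   Context: Let $\mathfrak h$ be a one-dimensional complex vector space with a non-degenerate symmetric bilinear form $(\cdot,\cdot)$, with Heisenberg algebra spanned by $h(n)$ ($h\in\mathfrak h,n\in\mathbb Z$) and central $K=1$, $[h(n),h'(k)]=n(h,h')\delta_{n+k,0}$. For $\gamma\in\mathfrak h$ let $M(1,\gamma)$ be the Fock module generated by $e^\gamma$ with $h(n)e^\gamma=0$ ($n>0$), $h(0)e^\gamma=(h,\gamma)e^\gamma$. Put $V_{\mathfrak h}=\bigoplus_{\gamma\in\mathfrak h}M(1,\gamma)$, $V_{\mathfrak h}^\gamma=M(1,\gamma)$, and define operators $e^\gamma(n)$ ($n\in\mathbb C$) on $V_{\mathfrak h}$ by $$\sum_{n\in\mathbb C}e^\gamma(n)z^{-n-1}=\exp\Bigl(\sum_{n<0}\tfrac{\gamma(n)}{-n}z^{-n}\Bigr)\exp\Bigl(\sum_{n>0}\tfrac{\gamma(n)}{-n}z^{-n}\Bigr)e_\gamma z^{\gamma(0)},$$ where $z^{\gamma(0)}$ acts on $M(1,\delta)$ by $z^{(\gamma,\delta)}$ and $e_\gamma:M(1,\delta)\to M(1,\gamma+\delta)$ commutes with $h(n)$,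 $n\neq0$, and sends $e^\delta$ to $e^{\gamma+\delta}$. Let $\beta\in\mathfrak h$ with $(\beta,\beta)=g$, $\beta^\circ=\beta/g$, $L=\mathbb Z\beta$. $W_L$ is the generalized vertex subalgebra of $V_{\mathfrak h}$ generated by $e^\beta$, and for $\mu\in\mathbb C$, $W_L(\mu\beta^\circ)=W_L\cdot e^{\mu\beta^\circ}$ is the cyclic $W_L$-module generated by $e^{\mu\beta^\circ}$; concretely it is the smallest subspace of $V_{\mathfrak h}$ containing $e^{\mu\beta^\circ}$ and stable under all $e^\beta(n)$, $n\in\mathbb C$. Since $e^\beta$ generates $W_L$, a $W_L$-module homomorphism is a linear map commuting with all $e^\beta(n)$. The map $\varepsilon$ is the sign twist acting on $W_L(m\beta^\circ)\cap V_{\mathfrak h}^{m\beta^\circ+r\beta}$ by $(-1)^r$, $r\in\mathbb Z$ (needed because $e^{\beta^\circ}(k)$ anticommutes with $e^\beta(n)$). *)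

(* Defs.v *)
From HB Require Import structures.
From mathcomp Require Import all_boot all_order all_algebra.
From mathcomp Require Import finmap multiset monalg.
From mathcomp Require Import complex ring.
From mathcomp Require Import boolp classical_sets functions fsbigop reals.

Set Implicit Arguments.
Unset Strict Implicit.
Unset Printing Implicit Defensive.

Import GRing.Theory Num.Theory.
Local Open Scope classical_set_scope.
Local Open Scope ring_scope.

(* V_h, as the space of finitely supported functions on pairs (delta, A).     *)
(* With b = hbasis h a basis of the one-dimensional space h, the basis vector *)
(* << (delta, A) >> is (\prod_(j <- A) b(-(j + 1))) e^delta, so that those    *)
(* with delta fixed form the usual (PBW) basis of M(1, delta).                *)
Notation fock R h := {malg R[i]%C[(h * {mset nat}%mset)%type]}.

Section Fock.
Context {R : realType} {h : vectType R[i]}.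
Local Notation V := (fock R h).
Implicit Types (a gamma delta : h) (f : h * {mset nat}%mset -> V).
Implicit Types (v : V) (U : set V).

Definition hbasis (h : vectType R[i]) : h := vpick {:h}.

Definition linext (f : h * {mset nat}%mset -> V) v : V :=
  \sum_(k <- msupp v) v@_k *: f k.

Definition vac gamma : V := << (gamma, mset0) >>.

(* the projection of V_h onto its summand M(1, delta) *)
Definition fproj delta : V -> V :=
  linext (fun k => if k.1 == delta then << k >> else 0).

(* the operator e_gamma *)
Definition fshift gamma : V -> V :=
  linext (fun k => << (gamma + k.1, k.2) >>).

(* For a_1, a_2, ... operators on V, expow_coef a i p is the coefficient of   *)
(* z^p in (\sum_(k >= 1) a_k z^k)^i, and exp_coef a p its coefficient in      *)
(* exp (\sum_(k >= 1) a_k z^k), where the terms i > p do not contribute.      *)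
Fixpoint expow_coef (a : nat -> V -> V) (i p : nat) v : V :=
  if i is i'.+1 then \sum_(1 <= k < p.+1) a k (expow_coef a i' (p - k) v)
  else if p == 0 then v else 0.

Definition exp_coef (a : nat -> V -> V) (p : nat) v : V :=
  \sum_(i < p.+1) (i`!%:R)^-1 *: expow_coef a i p v.

(* the sign twist: (-1)^r on M(1, gamma + r beta), for r in Z *)
Definition sign_twist beta gamma v : V :=
  \sum_(r \in [set: int]) (-1) ^ r *: fproj (gamma + beta *~ r) v.

Lemma linextE f (d : {fset (h * {mset nat}%mset)%type}) v :
  (msupp v `<=` d)%fset -> linext f v = \sum_(k <- d) v@_k *: f k.
Proof.
move=> sub; rewrite /linext; apply: (big_fset_incl _ sub) => k _.
by move=> /mcoeff_outdom ->; rewrite scale0r.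
Qed.

Lemma linext_is_linear f : linear (linext f).
Proof.
move=> c u v; pose d := (msupp u `|` msupp v)%fset.
have su : (msupp u `<=` d)%fset by apply: fsubsetUl.
have sv : (msupp v `<=` d)%fset by apply: fsubsetUr.
have s : (msupp (c *: u + v) `<=` d)%fset.
  apply: fsubset_trans (msuppD_le _ _) _; rewrite fsubUset sv andbT.
  exact: fsubset_trans (msuppZ_le _ _) su.
rewrite !(@linextE _ d) // scaler_sumr -big_split /=; apply: eq_bigr => k _.
by rewrite mcoeffD mcoeffZ scalerDl scalerA.
Qed.

HB.instance Definition _ f :=
  GRing.isLinear.Build R[i]%C V V *:%R (linext f) (linext_is_linear f).

Lemma linextU f k : linext f << k >> = f k.
Proof.
by rewrite /linext msuppU oner_eq0 big_seq_fset1 mcoeffUU scale1r.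
Qed.

Lemma linext_ext (f g : V -> V) : linear f -> linear g ->
  (forall k, f << k >> = g << k >>) -> f =1 g.
Proof.
move=> lf lg fg v.
pose F : {linear V -> V} := HB.pack f (GRing.isLinear.Build _ _ _ _ f lf).
pose G : {linear V -> V} := HB.pack g (GRing.isLinear.Build _ _ _ _ g lg).
rewrite (_ : v = \sum_(k <- msupp v) v@_k *: << k >>).
  rewrite -[f]/(F : V -> V) -[g]/(G : V -> V) !linear_sum.
  by apply: eq_bigr => k _; rewrite !linearZ /= fg.
rewrite [LHS]monalgE; apply: eq_bigr => k _; apply/malgP => k'.
by rewrite mcoeffZ !mcoeffU mulr_natr.
Qed.

Section OneDimensional.
Hypothesis dim : \dim {:h} = 1%N.

Lemma hbasis_neq0 : hbasis h != 0.
Proof. by rewrite vpick0 -dimv_eq0 dim. Qed.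

Lemma coord_hbasis (a : h) : a = coord [tuple hbasis h] ord0 a *: hbasis h.
Proof.
have : a \in <<[tuple hbasis h]>>%VS.
  suff -> : <<[tuple hbasis h]>>%VS = fullv by rewrite memvf.
  apply/eqP; rewrite eqEdim subvf span_seq1 dim dim_vline.
  by rewrite hbasis_neq0.
by move/coord_span; rewrite big_ord1.
Qed.

End OneDimensional.

Section Form.
Variable form : {symmetric h}.

(* heis a n is the operator a(n), for a in h and n in Z (Negz j = -(j + 1)).  *)
(* For n > 0, a(n) is the derivation commuting with e^delta and sending       *)
(* b(-n) to n (a, b).                                                         *)
Definition heis a (n : int) : V -> V :=
  match n with
  | Negz j => linext (fun k =>
      coord [tuple hbasis h] ord0 a *: << (k.1, (j +` k.2)%mset) >>)
  | Posz 0 => linext (fun k => form a k.1 *: << k >>)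
  | Posz j.+1 => linext (fun k =>
      (j.+1%:R * form a (hbasis h) * (k.2 j)%:R) *:
        << (k.1, (k.2 `\ j)%mset) >>)
  end.

(* the coefficient of z^p in exp (\sum_(n < 0) gamma(n) / (-n) z^(-n)) *)
Definition Eminus gamma : nat -> V -> V :=
  exp_coef (fun k v => k%:R^-1 *: heis gamma (- k%:Z) v).

(* the coefficient of z^(-q) in exp (\sum_(n > 0) gamma(n) / (-n) z^(-n)) *)
Definition Eplus gamma : nat -> V -> V :=
  exp_coef (fun k v => - k%:R^-1 *: heis gamma k%:Z v).

(* the coefficient of z^s in z^(gamma(0)) v, for s a complex number *)
Definition zpow gamma (s : R[i]) v : V :=
  \sum_(delta \in [set delta | form gamma delta = s]) fproj delta v.

(* The operator e^gamma(n): the coefficient of z^(-n-1) in the defining       *)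
(* product. Its terms are z^p z^(-q) z^s with p - q + s = - n - 1, and only   *)
(* finitely many of them do not vanish on a given v.                          *)
Definition vop gamma (n : R[i]) v : V :=
  \sum_(pq \in [set: nat * nat])
    Eminus gamma pq.1 (Eplus gamma pq.2 (fshift gamma
      (zpow gamma (- n - 1 - pq.1%:R + pq.2%:R) v))).

(* The subspaces of V_h that are W_L-modules, for L = Z beta: as e^beta       *)
(* generates W_L, stability under the e^beta(n), n complex, is enough.        *)
Definition WL_module beta U :=
  submod_closed [in U] /\ forall n v, U v -> U (vop beta n v).

(* the cyclic W_L-module W_L e^gamma *)
Definition WL beta gamma : set V :=
  smallest (WL_module beta) [set vac gamma].

Definition WL_hom beta (U U' : set V) (f : V -> V) :=
  [/\ forall v, U v -> U' (f v),
      forall (c : R[i]) u v, U u -> U v -> f (c *: u + v) = c *: f u + f v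
    & forall n v, U v -> f (vop beta n v) = vop beta n (f v)].

(* 0 -> U1 -f-> U2 -f'-> U3 -> 0 is an exact sequence of W_L-modules. *)
Definition WL_short_exact beta (U1 U2 U3 : set V) (f f' : V -> V) :=
  [/\ [/\ WL_module beta U1, WL_module beta U2 & WL_module beta U3],
      WL_hom beta U1 U2 f /\ WL_hom beta U2 U3 f',
      set_inj U1 f,
      f @` U1 = [set v | U2 v /\ f' v = 0]
    & f' @` U2 = U3].

Lemma heis_is_linear a n : linear (heis a n).
Proof. by case: n => [[|j]|j]; apply: linext_is_linear. Qed.

HB.instance Definition _ a n :=
  GRing.isLinear.Build R[i]%C V V *:%R (heis a n) (heis_is_linear a n).

Lemma formC (a b : h) : form a b = form b a.
Proof. by rewrite hermitian_subproof expr0 mul1r. Qed.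

Lemma comm_is_linear (F G : {linear V -> V}) :
  linear (fun v => F (G v) - G (F v)).
Proof.
move=> c u v; rewrite (linearP G) (linearP F) (linearP F) (linearP G).
by rewrite scalerBr opprD addrACA.
Qed.

Lemma scale_is_linear (c : R[i]%C) : linear (fun v : V => c *: v).
Proof. by move=> d u v; rewrite scalerDr !scalerA mulrC. Qed.

Lemma heisNU a j d A : heis a (Negz j) << (d, A) >> =
  coord [tuple hbasis h] ord0 a *: << (d, (j +` A)%mset) >>.
Proof. exact: linextU. Qed.

Lemma heis0U a d A : heis a 0 << (d, A) >> = form a d *: << (d, A) >>.
Proof. exact: linextU. Qed.

Lemma heisPU a (j : nat) d A : heis a (Posz j.+1) << (d, A) >> =
  (j.+1%:R * form a (hbasis h) * (A j)%:R) *: << (d, (A `\ j)%mset) >>.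
Proof. exact: linextU. Qed.

Lemma heisZ a n c v : heis a n (c *: v) = c *: heis a n v.
Proof. exact: linearZ. Qed.


Lemma heis0_vac a d : heis a 0 (vac d) = form a d *: vac d.
Proof. exact: heis0U. Qed.

Lemma heisP_vac a (j : nat) d : heis a (Posz j.+1) (vac d) = 0.
Proof. by rewrite (heisPU a j d mset0) mset0E mulr0 scale0r. Qed.

Local Opaque heis.
(* the Heisenberg relations, with K = 1 *)
Lemma heisC (a a' : h) (n k : int) v : \dim {:h} = 1%N ->
  heis a n (heis a' k v) - heis a' k (heis a n v) =
  (if n + k == 0 then n%:~R * form a a' else 0) *: v.
Proof.
move=> dim; move: v; apply: linext_ext.
- exact: (comm_is_linear (heis a n) (heis a' k)).
- exact: scale_is_linear.
move=> [d A].
have cf (x y : h) :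
    form x y = coord [tuple hbasis h] ord0 y * form x (hbasis h).
  by rewrite {1}(coord_hbasis dim y) linearZ.
have main j i (x y : h) :
  heis x (Posz j.+1) (heis y (Negz i) << (d, A) >>)
   - heis y (Negz i) (heis x (Posz j.+1) << (d, A) >>)
   = ((j == i)%:R * (j.+1%:R * form x y)) *: << (d, A) >>.
  rewrite (heisNU y i d A) (heisPU x j d A) (heisZ x) (heisZ y).
  rewrite (heisNU y i d _) (heisPU x j d _) !scalerA mset1DE (cf x y) natrD.
  set c := coord _ _ _; set b := form _ _; set e := _.+1%:R.
  have [->|ne] := eqVneq j i.
    rewrite msetD1K.
    have [A0|Apos] := posnP (A i).
      by rewrite A0 !(mulr0, mul0r) scale0r subr0 addr0; congr (_ *: _); ring.
    by rewrite msetB1K -?mset_gt0 // -scalerBl; congr (_ *: _); ring.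
  rewrite mul0r scale0r add0r.
  rewrite (_ : ((i +` A) `\ j)%mset = (i +` (A `\ j))%mset).
    rewrite -scalerBl -[RHS](scale0r << (d, (i +` (A `\ j))%mset) >>).
    by congr (_ *: _); ring.
  apply/msetP => l; rewrite !msetE2 !msetnE.
  by case: (eqVneq l i) => [->|] //; rewrite eq_sym (negPf ne) !subn0.
have zero x y (l : int) : heis x 0 (heis y l << (d, A) >>) =
    heis y l (heis x 0 << (d, A) >>).
  rewrite (heis0U x d A) (heisZ y); case: l => [[|l]|l].
  - by rewrite (heis0U y d A) (heisZ x) (heis0U x d A) !scalerA mulrC.
  - by rewrite (heisPU y l d A) (heisZ x) (heis0U x d _) !scalerA mulrC.
  - by rewrite (heisNU y l d A) (heisZ x) (heis0U x d _) !scalerA mulrC.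
case: n k => [[|j]|j] [[|i]|i].
- by rewrite (zero a a' 0) subrr mulr0z mul0r; case: (_ == _); rewrite scale0r.
- by rewrite zero subrr mulr0z mul0r; case: (_ == _); rewrite scale0r.
- by rewrite zero subrr mulr0z mul0r; case: (_ == _); rewrite scale0r.
- by rewrite (zero a') subrr /= scale0r.
- rewrite /= scale0r (heisPU a' i d A) (heisPU a j d A) (heisZ a) (heisZ a').
  rewrite (heisPU a' i d _) (heisPU a j d _) !scalerA !msetB1E.
  rewrite (_ : (A `\ i `\ j)%mset = (A `\ j `\ i)%mset); last first.
    by apply/msetP => l; rewrite !msetB1E subnAC.
  rewrite -scalerBl -[RHS](scale0r << (d, (A `\ j `\ i)%mset) >>).
  congr (_ *: _).
  have [->|ne] := eqVneq i j; first by ring.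
  by rewrite !subn0; ring.
- rewrite main.
  have [->|ne] := eqVneq j i.
    by rewrite NegzE subrr eqxx mul1r.
  rewrite mul0r NegzE subr_eq0 eqz_nat eqSS (negPf ne) //.
- by rewrite (zero a') subrr /= scale0r.
- rewrite -opprB main -scaleNr; congr (_ *: _).
  have [->|ne] := eqVneq i j.
    by rewrite NegzE addrC subrr eqxx mul1r formC mulrNz mulNr.
  by rewrite mul0r oppr0 NegzE addrC subr_eq0 eqz_nat eqSS (negPf ne).
- rewrite /= scale0r (heisNU a' i d A) (heisNU a j d A) (heisZ a) (heisZ a').
  rewrite (heisNU a' i d _) (heisNU a j d _) !scalerA.
  by rewrite (msetDCA [mset i]%mset) -scalerBl mulrC subrr scale0r.
Qed.

End Form.
End Fock.

(* Main.v *)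
Require Import Defs.
From HB Require Import structures.
From mathcomp Require Import all_boot all_order all_algebra.
From mathcomp Require Import finmap multiset monalg.
From mathcomp Require Import complex ring.
From mathcomp Require Import boolp classical_sets functions fsbigop.
From mathcomp Require Import reals.

Set Implicit Arguments.
Unset Strict Implicit.
Unset Printing Implicit Defensive.

Import Order.TTheory GRing.Theory Num.Theory.
Local Open Scope ring_scope.

(** Put [h(z) = \sum_p h_p z^p] for the creation half
    [exp (\sum_(n > 0) beta(-n) z^n / n)] of the vertex operator of [e^beta].
    Its coefficients [h_p] are the complete symmetric functions in the
    commuting creation operators: [h_0 = 1], and [h_p = 0] for [p < 0].

    For every [gamma] the cyclic module [W_L e^gamma] is the span of the vectors
    [h_(p_1) ... h_(p_k) e^(gamma + k beta)], for all [k] and all integers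
    [p_1, ..., p_k].  The annihilation half of [e^beta(z)] lowers the indices
    [p_i] and its creation half adds one more factor, so this span is stable
    ([WLspan_vop]); conversely, by induction on [k] and on the sum of the [p_i],
    the vectors [h_n h_(p_1) ... h_(p_k) e^(gamma + (k+1) beta)] are extracted
    from the images of those with [k] factors ([hmon_generated],
    [WLspan_minimal]).  As [h_0 = 1], the module of [gamma + beta] is the subspace
    spanned by the vectors that have some [p_i = 0].

    Let [bo] be [beta / g].  As [(bo, beta) = 1], the annihilation half of
    [e^bo(z)] satisfies [A(z) h(w) = (1 - w/z) h(w) A(z)]: it replaces every [h_p]
    by [h_p - z^-1 h_(p-1)] ([A_E]).  On a product of [k] factors the given mode of
    [e^bo] extracts the coefficient of [z^-k], which after the sign twist is
      [h_(p_1) ... h_(p_k) |-> h_(p_1 - 1) ... h_(p_k - 1)]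
    ([intertwiner_mon]).  In this form it is clear that the map is onto, that it
    commutes with the [e^beta(n)] ([intertwiner_vop]) and that it kills the module
    of [gamma + beta].  That its kernel is not larger follows from the linear
    independence of the monomials in [h_0, h_1, ...] of a given length, which is
    proved with the same map ([realize_inj_bounded]): applied to a linear relation
    it lowers all the indices, so by induction the relation only involves
    monomials with a factor [h_0 = 1], and is a relation in smaller length.

    The argument takes place in a vector space with operators that satisfy the
    relations of the Fock space; these are then verified for the Fock space
    itself. *)

(** * Linear subspaces *)

Section Subspace.
Context {K : numFieldType} {W : lmodType K}.
Implicit Types (P : W -> Prop) (u v : W).

Definition subspace P := P 0 /\ forall (c : K) u v, P u -> P v -> P (c *: u + v).

Lemma subspace0 P : subspace P -> P 0.
Proof. by case. Qed.

Lemma subspaceP P (c : K) u v : subspace P -> P u -> P v -> P (c *: u + v).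
Proof. by case=> _; apply. Qed.

Lemma subspaceZ P (c : K) v : subspace P -> P v -> P (c *: v).
Proof. by move=> [P0 PD] Pv; rewrite -[_ *: _]addr0; apply: PD. Qed.

Lemma subspaceVZ P (c : K) v : subspace P -> c != 0 -> P (c *: v) -> P v.
Proof. by move=> sP c0 /(subspaceZ c^-1 sP); rewrite scalerA mulVf // scale1r. Qed.

Lemma subspaceD P u v : subspace P -> P u -> P v -> P (u + v).
Proof. by move=> [P0 PD] Pu Pv; rewrite -[u]scale1r; apply: PD. Qed.

Lemma subspaceN P v : subspace P -> P v -> P (- v).
Proof. by move=> sP Pv; rewrite -scaleN1r; apply: subspaceZ. Qed.

Lemma subspaceB P u v : subspace P -> P u -> P v -> P (u - v).
Proof. by move=> sP Pu Pv; apply: subspaceD => //; apply: subspaceN. Qed.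

Lemma subspace_sum P (I : eqType) (r : seq I) (F : I -> W) :
  subspace P -> (forall i, i \in r -> P (F i)) -> P (\sum_(i <- r) F i).
Proof.
move=> sP PF; rewrite big_seq; apply: big_ind => //; first by case: sP.
by move=> u v; apply: subspaceD.
Qed.

Lemma subspace_preim P (f : {linear W -> W}) :
  subspace P -> subspace (fun v => P (f v)).
Proof.
move=> [P0 PD]; split=> [|c u v Pu Pv]; first by rewrite linear0.
by rewrite linearP; apply: PD.
Qed.

Lemma subspace_eq (f g : {linear W -> W}) : subspace (fun v => f v = g v).
Proof.
split=> [|c u v fu fv]; first by rewrite !linear0.
by rewrite !linearP fu fv.
Qed.

Lemma subspace_eq0 : subspace (fun v => v = 0).
Proof. by split=> [//|c u v -> ->]; rewrite scaler0 addr0. Qed.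

End Subspace.

(** * Exponentials of commuting operators *)

Section Exp.
Context {K : numFieldType} {W : lmodType K}.

(** For [A(z) = \sum_k a'_k z^k] and [E = exp A], this is the equation
    [z E' = (z A') E] with [E 0 = 1], where [a k = k a'_k]. *)
Definition exp_family (a : nat -> W -> W) (E : int -> W -> W) :=
  [/\ forall j v, E (Negz j) v = 0, forall v, E 0 v = v
    & forall (p : nat) v,
        p%:R *: E p v = \sum_(1 <= k < p.+1) a k (E (p - k)%N v)].

(* [X i p] is the coefficient of [z^p] in [(\sum_(k >= 1) a_k z^k)^i]. *)
Variables (a : nat -> {linear W -> W}) (X : nat -> nat -> W -> W).
Hypothesis aC : forall k l v, a k (a l v) = a l (a k v).
Hypothesis X0 : forall p v, X 0 p v = if p == 0 then v else 0.
Hypothesis XS : forall i p v,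
  X i.+1 p v = \sum_(1 <= k < p.+1) a k (X i (p - k) v).
Let E p v := \sum_(i < p.+1) (i`!%:R)^-1 *: X i p v.

Lemma expow_linear i p : linear (X i p).
Proof.
elim: i p => [|i IH] p c u v.
  by rewrite !X0; case: (p == 0); rewrite // scaler0 addr0.
rewrite !XS scaler_sumr -big_split; apply: eq_bigr => k _ /=.
by rewrite IH linearP.
Qed.

Lemma exp_linear p : linear (E p).
Proof.
move=> c u v; rewrite /E scaler_sumr -big_split; apply: eq_bigr => i _ /=.
by rewrite expow_linear scalerDr !scalerA mulrC.
Qed.

Lemma expow_comm (f : {linear W -> W}) :
  (forall k v, (0 < k)%N -> f (a k v) = a k (f v)) ->
  forall i p v, f (X i p v) = X i p (f v).
Proof.
move=> fa; elim=> [|i IH] p v; first by rewrite !X0; case: eqP; rewrite ?linear0.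
rewrite !XS linear_sum !big_nat; apply: eq_bigr => k /andP[k0 _].
by rewrite fa // IH.
Qed.

Lemma exp_comm (f : {linear W -> W}) :
  (forall k v, (0 < k)%N -> f (a k v) = a k (f v)) ->
  forall p v, f (E p v) = E p (f v).
Proof.
move=> fa p v; rewrite /E linear_sum; apply: eq_bigr => k _.
by rewrite linearZ /= expow_comm.
Qed.

Lemma expow_small i p v : (p < i)%N -> X i p v = 0.
Proof.
elim: i p => [|i IH] p // ltpi; rewrite XS big_nat_cond big1 // => k.
rewrite andbT => /andP[k0 kp]; rewrite IH ?linear0 //.
by rewrite -subSn // leq_subLR (leq_trans ltpi) // -[i.+1]add1n leq_add2r.
Qed.

Lemma exp_widen M p v : (p < M)%N ->
  E p v = \sum_(i < M) (i`!%:R)^-1 *: X i p v.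
Proof.
move=> pM; pose F i := (i`!%:R)^-1 *: X i p v.
rewrite /E (big_ord_widen _ F pM).
rewrite big_mkcond; apply: eq_bigr => i _; case: ltnP => // lt.
by rewrite /F expow_small ?scaler0.
Qed.

(** The coefficientwise form of [z (A^(i+1))' = (i+1) (z A') A^i]. *)
Lemma expow_rec i p v : p%:R *: X i.+1 p v =
  i.+1%:R *: \sum_(1 <= k < p.+1) k%:R *: a k (X i (p - k) v).
Proof.
elim: i p => [|i IH] p.
  rewrite scale1r XS scaler_sumr !big_nat; apply: eq_bigr => k /andP[k0 kp].
  rewrite X0; case: eqP => [|_]; last by rewrite linear0 !scaler0.
  by move=> /eqP; rewrite subn_eq0 => pk; rewrite (@anti_leq k p) // pk -ltnS kp.
have -> : p%:R *: X i.+2 p v =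
    \sum_(1 <= k < p.+1) (k%:R *: a k (X i.+1 (p - k) v) +
      (i.+1%:R *: \sum_(1 <= l < (p - k).+1)
                    l%:R *: a k (a l (X i (p - k - l) v)))).
  rewrite (XS i.+1) scaler_sumr !big_nat.
  apply: eq_bigr => k /andP[k0 kp].
  have {1}-> : p%:R = k%:R + (p - k)%:R :> K by rewrite -natrD subnKC.
  rewrite scalerDl; congr (_ + _).
  rewrite -linearZ /= IH.
  rewrite linearZ /= linear_sum; congr (_ *: _).
  by apply: eq_bigr => l _; rewrite linearZ.
rewrite big_split -(natr1 i.+1) scalerDl scale1r addrC /=; congr (_ + _).
rewrite -scaler_sumr; congr (_ *: _).
under [LHS]eq_big_nat => k /andP[k0 kp].
  rewrite (big_nat_widen _ _ p.+1); last by rewrite ltnS leq_subr.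
  over.
rewrite (exchange_big_dep_nat xpredT) //=; rewrite !big_nat.
apply: eq_bigr => l /andP[l0 lp].
rewrite XS linear_sum scaler_sumr [RHS](big_nat_widen _ _ p.+1); last first.
  by rewrite ltnS leq_subr.
rewrite [LHS]big_nat_cond [RHS]big_nat_cond; apply: eq_big => [k|k _].
  case: (boolP (_ <= _ < _)%N) => //= /andP[k0 kp].
  by rewrite !ltnS leq_subRL // leq_subRL // addnC.
by rewrite aC subnAC.
Qed.

(** As the [a_k] commute, [z (exp A)' = (z A') (exp A)]. *)
Lemma exp_rec p v : p%:R *: E p v =
  \sum_(1 <= k < p.+1) k%:R *: a k (E (p - k) v).
Proof.
case: p => [|p]; first by rewrite scale0r big_geq.
rewrite {1}/E big_ord_recl X0 /= scaler0 add0r scaler_sumr.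
under [LHS]eq_bigr => i _.
  rewrite scalerA mulrC -scalerA expow_rec scalerA /bump /= add1n factS.
  rewrite natrM invfM mulrAC mulVf ?pnatr_eq0 // mul1r scaler_sumr.
  over.
rewrite exchange_big !big_nat; apply: eq_bigr => k /andP[k0 kp].
rewrite (@exp_widen p.+1); last first.
  by rewrite ltnS leq_subLR -[p.+1]add1n leq_add2r.
rewrite linear_sum scaler_sumr; apply: eq_bigr => i _.
by rewrite [in RHS]linearZ /= !scalerA mulrC.
Qed.

Lemma exp_0 v : E 0 v = v.
Proof. by rewrite /E big_ord1 X0 invr1 scale1r. Qed.

Lemma exp_family_exp (b : nat -> W -> W) (F : int -> W -> W) :
  (forall k v, (0 < k)%N -> k%:R *: a k v = b k v) ->
  (forall j v, F (Negz j) v = 0) -> (forall (p : nat) v, F p v = E p v) ->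
  exp_family b F.
Proof.
move=> ab FN FE; split=> // [v|p v]; first by rewrite FE exp_0.
rewrite FE exp_rec !big_nat; apply: eq_bigr => k /andP[k0 _].
by rewrite FE -ab.
Qed.

End Exp.

Section ScaledFamily.
Context {K : numFieldType} {W : lmodType K}.

Lemma scale_comm (f f' : {linear W -> W}) (c c' : K) v :
  (forall w, f (f' w) = f' (f w)) ->
  (c \*: f) ((c' \*: f') v) = (c' \*: f') ((c \*: f) v).
Proof. by move=> ff'; rewrite /= !linearZ /= ff' !scalerA mulrC. Qed.

Lemma scale_natK (k : nat) (w : W) : (0 < k)%N -> k%:R *: (k%:R^-1 *: w) = w.
Proof. by move=> k0; rewrite scalerA mulfV ?scale1r // pnatr_eq0 -lt0n. Qed.

Lemma scale_natNK (k : nat) (w : W) :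
  (0 < k)%N -> k%:R *: (- k%:R^-1 *: w) = - w.
Proof. by move=> k0; rewrite scaleNr scalerN scale_natK. Qed.

Lemma eq_addl_of_sub (u v w : W) : u - v = w -> u = v + w.
Proof. by move=> <-; rewrite addrC subrK. Qed.

End ScaledFamily.

(** * Finitely supported sums *)

Section FiniteSums.
Context {K : numFieldType} {W : lmodType K} {T : choiceType}.

Definition supported_in (D : set T) (F : T -> W) (r : seq T) :=
  forall t, D t -> F t != 0 -> t \in r.

Lemma fsum_seq (D : set T) (F : T -> W) (r : seq T) : uniq r ->
  supported_in D F r -> \sum_(t \in D) F t = \sum_(t <- r | t \in D) F t.
Proof.
move=> ur Fr; rewrite fsbig_mkcond.
rewrite (fsbigTE [fset t in r]%fset) => [|t]; last first.
  rewrite inE /= /patch; case: ifP => // tD; apply: contraNeq; apply: Fr.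
  exact: set_mem.
rewrite [RHS]big_mkcond; apply: perm_big.
by rewrite uniq_perm // => t; rewrite !inE.
Qed.

Lemma fsum_linear (D : set T) (G : T -> {linear W -> W}) :
  (forall v, exists r, supported_in D (G ^~ v) r) ->
  linear (fun v => \sum_(t \in D) G t v).
Proof.
move=> Gr c u v; have [[ru Gu] [rv Gv]] := (Gr u, Gr v).
have ur : uniq (undup (ru ++ rv)) by apply: undup_uniq.
have H w : (forall t, D t -> G t w != 0 -> t \in ru ++ rv) ->
    \sum_(t \in D) G t w = \sum_(t <- undup (ru ++ rv) | t \in D) G t w.
  by move=> Gw; apply: fsum_seq => // t Dt /(Gw _ Dt); rewrite mem_undup.
rewrite !H => [|t Dt|t Dt|t Dt]; last 3 first.
- by move=> /(Gv _ Dt); rewrite mem_cat orbC => ->.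
- by move=> /(Gu _ Dt); rewrite mem_cat => ->.
- rewrite mem_cat linearP; apply: contraR.
  rewrite negb_or => /andP[tu tv].
  have -> : G t u = 0 by apply: contraNeq tu; apply: Gu.
  have -> : G t v = 0 by apply: contraNeq tv; apply: Gv.
  by rewrite scaler0 addr0.
rewrite scaler_sumr -big_split; apply: eq_bigr => t _ /=; exact: linearP.
Qed.

Lemma finitely_supported_subspace (D : set T) (G : T -> {linear W -> W}) :
  subspace (fun v => exists r, supported_in D (G ^~ v) r).
Proof.
split=> [|c u v [ru Gu] [rv Gv]].
  by exists [::] => t _; rewrite linear0 eqxx.
exists (ru ++ rv) => t Dt; rewrite mem_cat linearP; apply: contraR.
rewrite negb_or => /andP[tu tv].
have -> : G t u = 0 by apply: contraNeq tu; apply: Gu.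
have -> : G t v = 0 by apply: contraNeq tv; apply: Gv.
by rewrite scaler0 addr0.
Qed.

End FiniteSums.

(** * Linear extension from a basis *)

Section Malg.
Context {K : numFieldType} {T : choiceType}.
Local Notation M := {malg K[T]}.

Lemma malg_ind (P : M -> Prop) (f : M) :
  subspace P -> (forall k, f@_k != 0 -> P << k >>) -> P f.
Proof.
move=> sP Pk; have -> : f = \sum_(k <- msupp f) f@_k *: << k >>.
  rewrite [LHS]monalgE; apply: eq_bigr => k _; apply/malgP => k'.
  by rewrite mcoeffZ !mcoeffU mulr_natr.
apply: subspace_sum => // k.
by rewrite -mcoeff_neq0 => /Pk; apply: subspaceZ.
Qed.

Definition supp_in (D : T -> Prop) (f : M) := forall k, f@_k != 0 -> D k.

Lemma supp_in_subspace D : subspace (supp_in D).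
Proof.
split=> [k|c f g fD gD k]; first by rewrite mcoeff0 eqxx.
rewrite mcoeffD mcoeffZ => fg.
have [f0|/fD //] := eqVneq f@_k 0.
by apply: gD; apply: contraNneq fg => ->; rewrite f0 mulr0 addr0.
Qed.

Lemma supp_in_key (D : T -> Prop) k : D k -> supp_in D << k >>.
Proof. by move=> Dk k'; rewrite mcoeffU; case: (k =P k') => [<-|]; rewrite ?eqxx. Qed.

Section Extension.
Context {W : lmodType K}.
Variable F : T -> W.

Definition lext (f : M) : W := \sum_(k <- msupp f) f@_k *: F k.

Lemma lextE (d : {fset T}) f :
  (msupp f `<=` d)%fset -> lext f = \sum_(k <- d) f@_k *: F k.
Proof.
move=> sub; rewrite /lext; apply: (big_fset_incl _ sub) => k _.
by move=> /mcoeff_outdom ->; rewrite scale0r.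
Qed.

Lemma lext_is_linear : linear lext.
Proof.
move=> c f g; pose d := (msupp f `|` msupp g)%fset.
have sf : (msupp f `<=` d)%fset by apply: fsubsetUl.
have sg : (msupp g `<=` d)%fset by apply: fsubsetUr.
have s : (msupp (c *: f + g) `<=` d)%fset.
  apply: fsubset_trans (msuppD_le _ _) _; rewrite fsubUset sg andbT.
  exact: fsubset_trans (msuppZ_le _ _) sf.
rewrite !(@lextE d) // scaler_sumr -big_split /=; apply: eq_bigr => k _.
by rewrite mcoeffD mcoeffZ scalerDl scalerA.
Qed.

HB.instance Definition _ := GRing.isLinear.Build K M W *:%R lext lext_is_linear.

Lemma lextU k : lext << k >> = F k.
Proof. by rewrite /lext msuppU oner_eq0 big_seq_fset1 mcoeffUU scale1r. Qed.

End Extension.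

Lemma linear_eq_supp (W : lmodType K) (f1 f2 : {linear M -> W}) (D : T -> Prop) f :
  supp_in D f -> (forall k, D k -> f1 << k >> = f2 << k >>) -> f1 f = f2 f.
Proof.
move=> fD f12; apply: (malg_ind (P := fun f => f1 f = f2 f)) => [|k /fD /f12 //].
split=> [|c u v e1 e2]; first by rewrite !linear0.
by rewrite !linearP e1 e2.
Qed.

(** The basis elements, hence all formal sums, split into a part recovered from
    [l] by [r] and a part recovered from [d] by [a]. *)
Lemma lext_decomp (l r d a : T -> M) (f : M) :
  (forall k, lext a (d k) + lext r (l k) = << k >>) ->
  lext l f = 0 -> f = lext a (lext d f).
Proof.
move=> split_key lf0; pose fl : {linear M -> M} := lext r \o lext l.
pose fd : {linear M -> M} := lext a \o lext d.
rewrite -[RHS]addr0 -(linear0 (lext r)) -lf0.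
apply: (linear_eq_supp (f1 := idfun) (f2 := fd \+ fl) (D := xpredT)) => // k _.
by rewrite /= !lextU split_key.
Qed.

Lemma lext_supp1_inj (W : lmodType K) (F : T -> W) k0 (f : M) :
  supp_in (fun k => k = k0) f -> F k0 != 0 -> lext F f = 0 -> f = 0.
Proof.
move=> fk0 Fk0; have ef : f = f@_k0 *: << k0 >>.
  apply/malgP => k; rewrite mcoeffZ mcoeffU mulr_natr.
  have [<- //|ne] := eqVneq k0 k.
  by apply/eqP; apply: contraNT ne => /fk0 ->.
rewrite {1}ef linearZ /= lextU => /eqP; rewrite scaler_eq0 (negPf Fk0) orbF.
by move=> /eqP f0; rewrite ef f0 scale0r.
Qed.

End Malg.

Lemma lext_supp (K : numFieldType) (T T' : choiceType) (D : T -> Prop)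
    (D' : T' -> Prop) (F : T -> {malg K[T']}) f :
  supp_in D f -> (forall k, D k -> supp_in D' (F k)) -> supp_in D' (lext F f).
Proof.
move=> fD FD'; have sD' := @supp_in_subspace K _ D'.
apply: (malg_ind (P := fun f => supp_in D' (lext F f))) => [|k].
  split=> [|c u v uD vD]; first by rewrite linear0; exact: (subspace0 sD').
  by rewrite linearP; exact: (subspaceP c sD').
by move=> /fD Dk; rewrite lextU; apply: FD'.
Qed.

(** * Vertex operators built from a Heisenberg algebra *)

Section Heisenberg.
Context {K : numFieldType} {W : lmodType K}.

(** The recursion with a number of terms that does not depend on [n]: the terms
    with [k > n] vanish. *)
Lemma exp_family_rec (a : nat -> {linear W -> W}) E (M : nat) (n : int) v :
  exp_family a E -> n <= M ->
  n%:~R *: E n v = \sum_(1 <= k < M.+1) a k (E (n - k%:Z) v).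
Proof.
move=> [EN _ Erec]; case: n => [p|j] nM; last first.
  rewrite EN scaler0 big1 // => k _.
  by rewrite NegzE -opprD -PoszD addSn -NegzE EN linear0.
rewrite -pmulrn Erec (@big_cat_nat _ _ _ p.+1 1 M.+1) //= !big_nat.
rewrite [X in _ + X]big1 ?addr0.
  by apply: eq_bigr => k /andP[k0 kp]; rewrite subzn.
move=> k /andP[pk kM].
have -> : k = (p + (k - p.+1).+1)%N by rewrite -addSnnS subnKC.
by rewrite PoszD opprD addNKr -NegzE EN linear0.
Qed.

Section Operators.
Variables (y : nat -> {linear W -> W}) (E : int -> {linear W -> W}).
Hypothesis Ey : exp_family y E.
Hypothesis EC : forall n n' v, E n (E n' v) = E n' (E n v).

(** In the case of interest [E n] is the complete symmetric function [h_n] in the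
    commuting operators [y k], which are the power sums. *)
Definition hmon (s : seq int) (v : W) : W := foldr (fun p => E p) v s.

Lemma E_lt0 n v : n < 0 -> E n v = 0.
Proof. by case: Ey; case: n. Qed.

Lemma hmon_neg s v : has (< 0) s -> hmon s v = 0.
Proof.
elim: s => //= n s IH /orP[/E_lt0 -> // | /IH ->]; exact: linear0.
Qed.

Lemma hmon_sum_lt0 s v : \sum_(p <- s) p < 0 -> hmon s v = 0.
Proof.
move=> s0; apply: hmon_neg; apply: contraLR s0 => /hasPn s0.
by rewrite -leNgt big_seq sumr_ge0 // => p /s0; rewrite -leNgt.
Qed.

Lemma hmon_perm s t v : perm_eq s t -> hmon s v = hmon t v.
Proof.
elim: s t => [|n s IH] t; first by rewrite perm_sym => /perm_nilP ->.
move=> st; have /rot_to[i t' def_t] : n \in t by rewrite -(perm_mem st) mem_head.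
have -> : hmon t v = hmon (n :: t') v.
  rewrite -def_t /rot -{1}[t](cat_take_drop i) /hmon !foldr_cat.
  elim: (take i t) => [|p r] //= ->; rewrite -/(hmon _ _).
  elim: (drop i t) => //= m r' IH'; rewrite -IH' EC //.
rewrite /= (IH t') // -(perm_cons n); apply: perm_trans st _.
by rewrite -def_t perm_sym perm_rot.
Qed.

Section Newton.
Variables (P : W -> Prop) (v0 : W).
Hypothesis sP : subspace P.

(** Newton's identities [l h_l = \sum_k p_k h_(l-k)] express the power sums
    [p_l = y l] by the complete symmetric functions [h_l = E l]. *)
Lemma Newton_span (l : nat) s :
  (forall s, P (hmon s v0)) -> (0 < l)%N -> P (y l (hmon s v0)).
Proof.
move=> Ph; have [EN E0 Erec] := Ey; elim/ltn_ind: l s => -[//|l] IH s _.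
have := Erec l.+1 (hmon s v0); rewrite big_nat_recr //= subnn E0.
move=> /esym/(canRL (addKr _)) ->; rewrite addrC; apply: subspaceB => //.
  by apply: subspaceZ => //; apply: (Ph (l.+1%:Z :: s)).
apply: subspace_sum => // k; rewrite mem_index_iota => /andP[k0 kl].
by apply: (IH k _ ((l.+1 - k)%N%:Z :: s)).
Qed.

End Newton.

Section Annihilation.
Variables (x : nat -> {linear W -> W}) (A : int -> {linear W -> W}) (c : K).
Hypothesis xy : forall k l v, (0 < k)%N ->
  x k (y l v) = y l (x k v) + (if k == l then k%:R * c else 0) *: v.
Hypothesis Ax : exp_family (fun k v => - x k v) A.
Variable v0 : W.
Hypothesis xv0 : forall k, (0 < k)%N -> x k v0 = 0.

(** The identity [[x_k, E(z)] = c z^k E(z)], coefficient by coefficient. *)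
Lemma x_E k n v : (0 < k)%N ->
  x k (E n v) = E n (x k v) + c *: E (n - k%:Z) v.
Proof.
move=> k0; have [EN E0 _] := Ey.
suff H M : n < Posz M -> x k (E n v) = E n (x k v) + c *: E (n - k%:Z) v.
  by apply: (H `|n|%N.+1); rewrite -addn1 PoszD ltzD1 ler_norm.
elim: M n => [|M IH] n; last rewrite -addn1 PoszD ltzD1.
  by move=> n0; rewrite !E_lt0 ?linear0 ?scaler0 ?addr0 // subr_lt0 (lt_trans n0).
move=> nM; have [n0|n0|->] := ltgtP n 0; last 1 first.
- by rewrite sub0r !E0 (@E_lt0 (- _)) ?oppr_lt0 // scaler0 addr0.
- by rewrite !E_lt0 ?linear0 ?scaler0 ?addr0 // subr_lt0 (lt_trans n0).
have nK0 : n%:~R != 0 :> K by rewrite intr_eq0 gt_eqF.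
apply: (scalerI nK0); rewrite -linearZ (exp_family_rec _ Ey nM) linear_sum.
rewrite scalerDr (exp_family_rec _ Ey nM).
under eq_big_nat => l /andP[l0 lM].
  rewrite xy // IH; last first.
    by rewrite ltrBlDr (le_lt_trans nM) // ltrDl ltz_nat.
  rewrite linearD linearZ /= -addrA.
  over.
rewrite big_split; congr (_ + _) => /=.
rewrite big_split /= -scaler_sumr.
have -> : \sum_(1 <= l < M.+1) y l (E (n - l%:Z - k%:Z) v) =
    (n - k%:Z)%:~R *: E (n - k%:Z) v.
  rewrite (exp_family_rec _ Ey (M := M)); last by rewrite lerBlDr (le_trans nM) // lerDl.
  by apply: eq_bigr => l _; rewrite addrAC.
have -> : \sum_(1 <= l < M.+1) (if k == l then k%:R * c else 0) *: E (n - l%:Z) v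
    = (k%:R * c) *: E (n - k%:Z) v.
  have [kM|Mk] := leqP k M.
    rewrite (bigD1_seq k) ?iota_uniq ?mem_index_iota ?k0 //= eqxx big1 ?addr0 //.
    by move=> l /negPf; rewrite eq_sym => ->; rewrite scale0r.
  rewrite E_lt0 ?subr_lt0 ?(le_lt_trans nM) // scaler0 big_nat big1 // => l.
  case/andP=> _ lM; rewrite gtn_eqF ?scale0r //; exact: leq_trans lM _.
rewrite !scalerA -scalerDl; congr (_ *: _).
by rewrite rmorphB /= -pmulrn; ring.
Qed.

Lemma x_hmon P k s : subspace P -> (0 < k)%N ->
  (forall s', size s' = size s ->
    \sum_(p <- s') p + k%:Z = \sum_(p <- s) p -> P (hmon s' v0)) ->
  P (x k (hmon s v0)).
Proof.
move=> sP k0; elim: s P sP => [|n s IH] P sP Ps /=; first by rewrite xv0 //; case: sP.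
rewrite x_E //; apply: subspaceD => //.
  apply: (IH (fun w => P (E n w))) => [|s' ss' es']; first exact: subspace_preim.
  by apply: (Ps (n :: s')); rewrite /= ?ss' // !big_cons -addrA es'.
apply: subspaceZ => //; apply: (Ps (n - k%:Z :: s)) => //.
by rewrite !big_cons addrAC subrK.
Qed.

(** The annihilation operators act as derivations lowering the indices of the
    [E p], so their exponential [A] lowers the indices too. *)
Lemma A_hmon P (q : nat) s : subspace P ->
  (forall s', size s' = size s ->
    \sum_(p <- s') p + q%:Z = \sum_(p <- s) p -> P (hmon s' v0)) ->
  P (A q (hmon s v0)).
Proof.
have [_ A0 Arec] := Ax; elim/ltn_ind: q P => -[_|q IH] P sP Ps.
  by rewrite A0; apply: Ps => //; rewrite addr0.
have q0 : q.+1%:R != 0 :> K by rewrite pnatr_eq0.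
rewrite -[A _ _]scale1r -(mulVf q0) -scalerA; apply: subspaceZ => //.
rewrite Arec; apply: subspace_sum => // k; rewrite mem_index_iota => /andP[k0 kq].
apply: subspaceN => //.
apply: (IH (q.+1 - k)%N _ (fun w => P (x k w))) => [||s' ss' es'].
- by rewrite ltn_subrL k0.
- exact: subspace_preim.
apply: x_hmon => // s'' ss'' es''; apply: Ps; first by rewrite ss''.
by rewrite -es' -es'' -addrA -PoszD subnKC.
Qed.

Lemma A_hmon_eq0 (q : nat) s : \sum_(p <- s) p < q%:Z -> A q (hmon s v0) = 0.
Proof.
move=> sq; apply: (A_hmon (P := fun w => w = 0)) => [|s' _ es']; first exact: subspace_eq0.
by apply: hmon_sum_lt0; move: sq; rewrite -es' gtrDr.
Qed.

(** Induction on the total index of the monomial: the sum differs from its term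
    of index [q = 0], which is [E n] of the monomial, by terms in which [A q] has
    lowered the total index. *)
Lemma hmon_generated P d : subspace P ->
  (forall s n, size s = d -> exists Q,
    P (\sum_(q < Q.+1) E (n + q%:Z) (A q (hmon s v0)))) ->
  forall s n, size s = d -> P (E n (hmon s v0)).
Proof.
move=> sP Pvop; have [_ A0 _] := Ax.
suff H (M : nat) s n : \sum_(p <- s) p < M%:Z -> size s = d -> P (E n (hmon s v0)).
  move=> s n; apply: (H (absz (\sum_(p <- s) p)).+1) => //.
  by rewrite -addn1 PoszD ltzD1 ler_norm.
elim: M s n => [|M IH] s n sM sd.
  by rewrite hmon_sum_lt0 // linear0; case: sP.
have [Q] := Pvop s n sd; rewrite big_ord_recl addr0 A0 => PQ.
rewrite -[E n _](addrK (\sum_(i < Q) E (n + (bump 0 i)%:Z) (A (bump 0 i) (hmon s v0)))).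
apply: subspaceB => //; apply: subspace_sum => // i _.
apply: (A_hmon (P := fun w => P (E _ w))) => [|s' ss' es'].
  exact: subspace_preim.
apply: IH; last by rewrite ss'.
move: sM; rewrite -es' -addn1 PoszD ltzD1; apply: lt_le_trans.
by rewrite ltrDl.
Qed.

Lemma A_lt0 q v : q < 0 -> A q v = 0.
Proof. by case: Ax; case: q. Qed.

(** When [c = 1], the operators [A(z)] and [E(w)] commute up to the factor
    [exp (- \sum_k (w/z)^k / k) = 1 - w/z]. *)
Lemma A_E (q n : int) v : c = 1 ->
  A q (E n v) = E n (A q v) - E (n - 1) (A (q - 1) v).
Proof.
move=> c1; have [AN A0 _] := Ax; have Ax' : exp_family (fun k => \- x k) A by [].
suff H (M : nat) : q < M%:Z -> A q (E n v) = E n (A q v) - E (n - 1) (A (q - 1) v).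
  by apply: (H `|q|%N.+1); rewrite -addn1 PoszD ltzD1 ler_norm.
elim: M q => [|M IH] q; last rewrite -addn1 PoszD ltzD1.
  move=> q0; have q10 : q - 1 < 0 by rewrite subr_lt0 (lt_trans q0).
  by rewrite !A_lt0 // ![E _ 0]linear0 subr0.
move=> qM; have [q0|q0|->] := ltgtP q 0; last 1 first.
- by rewrite !A0 sub0r (@A_lt0 (- _)) // [E _ 0]linear0 subr0.
- have q10 : q - 1 < 0 by rewrite subr_lt0 (lt_trans q0).
  by rewrite !A_lt0 // ![E _ 0]linear0 subr0.
have qK0 : q%:~R != 0 :> K by rewrite intr_eq0 gt_eqF.
apply: (scalerI qK0); rewrite (exp_family_rec _ Ax' qM) scalerBr.
pose D (k : nat) := E (n - k%:Z) (A (q - k%:Z) v).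
transitivity (\sum_(1 <= k < M.+1) E n (- x k (A (q - k%:Z) v))
  - \sum_(1 <= k < M.+1) E (n - 1) (- x k (A (q - 1 - k%:Z) v))
  + \sum_(1 <= k < M.+1) (D k.+1 - D k)).
  rewrite -sumrB -big_split !big_nat; apply: eq_bigr => k /andP[k0 kM] /=.
  rewrite IH; last by rewrite ltrBlDr (le_lt_trans qM) // ltrDl ltz_nat.
  rewrite linearB /= !x_E // c1 !scale1r opprB opprD addrACA [in LHS]addrC.
  rewrite [X in _ + X]addrC [RHS]addrC !linearN /= opprK /D -addn1 PoszD.
  have e (p : int) : p - (k%:Z + 1) = p - 1 - k%:Z by ring.
  by rewrite !e [q - _ - _]addrAC.
(* the sum telescopes to the term [k = 1], as [A (q - k)] vanishes for [k > q] *)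
rewrite telescope_sumr // /D [A (q - M.+1%:Z) v]A_lt0; last first.
  by rewrite subr_lt0 -addn1 PoszD ltzD1.
rewrite linear0 sub0r -(linear_sum (E n)) -(linear_sum (E (n - 1))) /=.
have q1M : q - 1 <= M by rewrite lerBlDr (le_trans qM) // lerDl.
have rec (p : int) : p <= M ->
    \sum_(1 <= k < M.+1) - x k (A (p - k%:Z) v) = p%:~R *: A p v.
  by move=> pM; rewrite (exp_family_rec _ Ax' pM).
rewrite !rec // !linearZ /=.
by rewrite rmorphB /= scalerBl scale1r opprK addrA addrK.
Qed.

(** By [A_E], [A(z)] sends [E p] to [E p - z^-1 (E (p - 1))] in each factor of
    the monomial; these are its two highest coefficients in [z^-1]. *)
Lemma A_hmon_top (q : nat) s : c = 1 -> (size s <= q)%N ->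
  A q (hmon s v0) =
    if q == size s then (-1) ^+ q *: hmon [seq p - 1 | p <- s] v0 else 0.
Proof.
move=> c1; elim: s q => [|n s IH] q sq.
  case: q {sq} => [|q] /=; first by case: Ax => _ -> _; rewrite scale1r.
  by apply: (A_hmon_eq0 (s := [::])); rewrite big_nil.
case: q sq => // q; rewrite ltnS => sq /=; rewrite A_E // IH 1?leqW //.
rewrite gtn_eqF // linear0 sub0r -addn1 PoszD addrK IH // addn1 eqSS.
case: eqP => _; last by rewrite linear0 oppr0.
by rewrite linearZ exprS mulN1r scaleNr.
Qed.

End Annihilation.
End Operators.
End Heisenberg.

(** * The exact sequence from the relations of the Fock space *)

Section FockModule.
Context {K : numFieldType} {W L : lmodType K}.
(* [frm] is the bilinear form on the weights, [fshift a] the operator [e_a],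
   [fproj d] the projection onto the weight [d]; [Em a p] and [Ep a p] are the
   coefficients of the creation and annihilation halves of [e^a(z)], and [bo] is
   [beta / (beta, beta)]. *)
Variables (frm : L -> L -> K) (vac : L -> W).
Variables (heis : L -> int -> {linear W -> W}) (fshift fproj : L -> {linear W -> W}).
Variables (Em Ep : L -> int -> {linear W -> W}) (beta bo : L).
Implicit Types (a d gamma : L) (v w : W) (s t : seq int) (P : W -> Prop).

Hypothesis frmD : forall a d d', frm a (d + d') = frm a d + frm a d'.
Hypothesis frm_beta_bo : frm beta bo = 1.
Hypothesis frm_bo_beta : frm bo beta = 1.
Hypothesis beta_neq0 : beta != 0.
Hypothesis heisC : forall a a' n k v, heis a n (heis a' k v) =
  heis a' k (heis a n v) + (if n + k == 0 then n%:~R * frm a a' else 0) *: v.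
Hypothesis heis_vac : forall a (k : nat) d, (0 < k)%N -> heis a k%:Z (vac d) = 0.
Hypothesis vac_neq0 : forall d, vac d != 0.
Hypothesis fshift_heis : forall a a' n v, n != 0 ->
  fshift a (heis a' n v) = heis a' n (fshift a v).
Hypothesis fshift_vac : forall a d, fshift a (vac d) = vac (a + d).
Hypothesis fproj_heis : forall d a n v,
  fproj d (heis a n v) = heis a n (fproj d v).
Hypothesis fproj_vac : forall d d', fproj d (vac d') = if d' == d then vac d' else 0.
Hypothesis generated : forall P, subspace P -> (forall d, P (vac d)) ->
  (forall (l : nat) v, (0 < l)%N -> P v -> P (heis beta (- l%:Z) v)) ->
  forall v, P v.
Hypothesis Em_exp : forall a, exp_family (fun k v => heis a (- k%:Z) v) (Em a).
Hypothesis Ep_exp : forall a, exp_family (fun k v => - heis a k%:Z v) (Ep a).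
Hypothesis Em_comm : forall a (f : {linear W -> W}) n v,
  (forall (k : nat) v, (0 < k)%N -> f (heis a (- k%:Z) v) = heis a (- k%:Z) (f v)) ->
  f (Em a n v) = Em a n (f v).
Hypothesis Ep_comm : forall a (f : {linear W -> W}) n v,
  (forall (k : nat) v, (0 < k)%N -> f (heis a k%:Z v) = heis a k%:Z (f v)) ->
  f (Ep a n v) = Ep a n (f v).

(** The coefficient of [z^e] in [z^(a(0))], then the operator [e^a(n)] and the sign
    twist, in terms of the given operators. *)
Definition zpower a (e : K) v := \sum_(d \in [set d | frm a d = e]%classic) fproj d v.

Definition vertex_op a (n : K) v := \sum_(pq \in [set: nat * nat]%classic)
  Em a pq.1 (Ep a pq.2 (fshift a (zpower a (- n - 1 - pq.1%:R + pq.2%:R) v))).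

Definition twist gamma v :=
  \sum_(r \in [set: int]%classic) (-1) ^ r *: fproj (gamma + beta *~ r) v.

Local Notation mon := (hmon (Em beta)).

Lemma heis_comm a a' n k v : ((n == 0) || (n + k != 0)) ->
  heis a n (heis a' k v) = heis a' k (heis a n v).
Proof.
rewrite heisC; case/orP => [/eqP->|/negPf ->]; last by rewrite scale0r addr0.
by rewrite mul0r if_same scale0r addr0.
Qed.

Lemma Em_Em n n' v : Em beta n (Em beta n' v) = Em beta n' (Em beta n v).
Proof.
apply: Em_comm => k w k0; apply/esym/Em_comm => l u l0; apply: heis_comm.
by rewrite -opprD !oppr_eq0 [_ + _ == 0]gt_eqF ?orbT // addr_gt0.
Qed.

Lemma Ep_Ep a a' n n' v : Ep a n (Ep a' n' v) = Ep a' n' (Ep a n v).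
Proof.
apply: Ep_comm => k w k0; apply/esym/Ep_comm => l u l0; apply: heis_comm.
by rewrite [_ + _ == 0]gt_eqF ?orbT // addr_gt0.
Qed.

Lemma fshift_Ep a a' n v : fshift a (Ep a' n v) = Ep a' n (fshift a v).
Proof. by apply: Ep_comm => k w k0; apply: fshift_heis; rewrite gt_eqF. Qed.

Lemma fshift_mon a s d : fshift a (mon s (vac d)) = mon s (vac (a + d)).
Proof.
elim: s => [|n s IH] //=; rewrite -IH.
by apply: Em_comm => k w k0; apply: fshift_heis; rewrite oppr_eq0 gt_eqF.
Qed.

Lemma fproj_mon d s d' :
  fproj d (mon s (vac d')) = if d' == d then mon s (vac d') else 0.
Proof.
elim: s => [|n s IH] //=; rewrite Em_comm => [|k w k0]; last exact: fproj_heis.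
by rewrite -/(mon s _) IH; case: eqP => // _; rewrite linear0.
Qed.

(** The vacuum vectors generate everything under the [heis beta (- l)], and by
    Newton's identities the span of the monomials is stable under these. *)
Lemma mon_span P : subspace P -> (forall s d, P (mon s (vac d))) -> forall v, P v.
Proof.
move=> sP Pmon v; move: v P sP Pmon.
pose S v := forall P, subspace P -> (forall s d, P (mon s (vac d))) -> P v.
have sS : subspace S.
  split=> [P [] //|c u v Su Sv P sP Pmon].
  by case: (sP) => _; apply; [apply: Su | apply: Sv].
apply: (generated (P := S)) => // [d P sP Pmon|l v l0 Sv]; first exact: (Pmon [::]).
apply: (Sv (fun w => S (heis beta (- l%:Z) w))) => [|s d].
  exact: subspace_preim.
pose y k : {linear W -> W} := heis beta (- k%:Z).
apply: (Newton_span (y := y) (Em_exp beta) sS) => // s' P sP; exact.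
Qed.

Lemma heis_annih a k l v : (0 < k)%N ->
  heis a k%:Z (heis beta (- l%:Z) v) = heis beta (- l%:Z) (heis a k%:Z v) +
    (if k == l then k%:R * frm a beta else 0) *: v.
Proof. by move=> k0; rewrite heisC subr_eq0. Qed.

Lemma Ep_mon a P (q : nat) s d : subspace P ->
  (forall s', size s' = size s ->
    \sum_(p <- s') p + q%:Z = \sum_(p <- s) p -> P (mon s' (vac d))) ->
  P (Ep a q (mon s (vac d))).
Proof.
pose y k : {linear W -> W} := heis beta (- k%:Z).
pose x k : {linear W -> W} := heis a k%:Z.
apply: (A_hmon (y := y) (x := x) (Em_exp beta) (heis_annih a) (Ep_exp a)).
by move=> k; apply: heis_vac.
Qed.

Lemma Ep_mon_eq0 a (q : nat) s d :
  \sum_(p <- s) p < q%:Z -> Ep a q (mon s (vac d)) = 0.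
Proof.
pose y k : {linear W -> W} := heis beta (- k%:Z).
pose x k : {linear W -> W} := heis a k%:Z.
apply: (A_hmon_eq0 (y := y) (x := x) (Em_exp beta) (heis_annih a) (Ep_exp a)).
by move=> k; apply: heis_vac.
Qed.

(** The condition [c = 1] of [A_hmon_top] is the normalisation
    [frm bo beta = 1]. *)
Lemma Ep_bo_mon (q : nat) s d : (size s <= q)%N -> Ep bo q (mon s (vac d)) =
  if q == size s then (-1) ^+ q *: mon [seq p - 1 | p <- s] (vac d) else 0.
Proof.
pose y k : {linear W -> W} := heis beta (- k%:Z).
pose x k : {linear W -> W} := heis bo k%:Z.
apply: (A_hmon_top (y := y) (x := x) (Em_exp beta) (heis_annih bo) (Ep_exp bo)) => //.
by move=> k; apply: heis_vac.
Qed.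

Lemma zpow_support a (e : K) s d :
  supported_in [set d' | frm a d' = e]%classic (fproj^~ (mon s (vac d))) [:: d].
Proof.
by move=> d' _; rewrite fproj_mon inE; have [->|_] := eqVneq d d'; rewrite ?eqxx.
Qed.

Lemma zpow_mon a (e : K) s d :
  zpower a e (mon s (vac d)) = if frm a d == e then mon s (vac d) else 0.
Proof.
rewrite /zpower (fsum_seq (r := [:: d])) => [||]; [|by []|exact: zpow_support].
rewrite big_mkcond big_seq1 fproj_mon eqxx; case: eqP => adz.
  by rewrite ifT // inE.
by rewrite ifF //; apply/negbTE; apply/negP; rewrite inE.
Qed.

Lemma zpow_linear a (e : K) : linear (zpower a e).
Proof.
apply: fsum_linear; apply: mon_span => [|s d].
  exact: finitely_supported_subspace.
by exists [:: d]; apply: zpow_support.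
Qed.

HB.instance Definition _ a e :=
  GRing.isLinear.Build K W W *:%R (zpower a e) (zpow_linear a e).

Let vop_term a (n : K) (pq : nat * nat) : {linear W -> W} :=
  Em a pq.1 \o (Ep a pq.2 \o
    (fshift a \o zpower a (- n - 1 - pq.1%:R + pq.2%:R))).

Lemma vop_term_mon a n p q s d : vop_term a n (p, q) (mon s (vac d)) =
  if frm a d == - n - 1 - p%:R + q%:R
  then Em a p (Ep a q (mon s (vac (a + d)))) else 0.
Proof.
rewrite /vop_term /= zpow_mon; case: eqP => _; first by rewrite fshift_mon.
by rewrite !linear0.
Qed.

(** The pairs [(p, q)] with [p - q = N] and [q < Q]. *)
Let vop_indices (N : int) (Q : nat) :=
  [seq (absz (N + q%:Z), q) | q <- iota 0 Q & 0 <= N + q%:Z].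

Lemma vop_support a n (N : int) (Q : nat) s d :
  - n - 1 - frm a d = N%:~R -> \sum_(p <- s) p < Q%:Z ->
  supported_in [set: nat * nat]%classic
    ((vop_term a n)^~ (mon s (vac d))) (vop_indices N Q).
Proof.
move=> eN sQ [p q] _; rewrite vop_term_mon; case: (frm a d =P _) => [e|_]; last first.
  by rewrite eqxx.
have Nq : N + q%:Z = p.
  apply/eqP; rewrite -(eqr_int K) rmorphD /= -eN e -!pmulrn.
  by apply/eqP; ring.
have [Qq|qQ _] := leqP Q q.
  by rewrite Ep_mon_eq0 ?linear0 ?eqxx // (lt_le_trans sQ).
by apply/mapP; exists q; rewrite ?Nq // mem_filter Nq mem_iota.
Qed.

(** Only the operators [Em a p \o Ep a q] with [p - q = N] contribute, where
    [z^(-n-1)] is [z^N] times the power of [z] produced by [z^(a(0))]. *)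
Lemma vop_mon a n (N : int) (Q : nat) s d :
  - n - 1 - frm a d = N%:~R -> \sum_(p <- s) p < Q%:Z ->
  vertex_op a n (mon s (vac d)) =
    \sum_(q < Q) Em a (N + q%:Z) (Ep a q (mon s (vac (a + d)))).
Proof.
move=> eN sQ; rewrite /vertex_op (fsum_seq (r := vop_indices N Q)); last 2 first.
- rewrite map_inj_uniq ?filter_uniq ?iota_uniq // => q q' [] //.
- exact: vop_support.
rewrite (eq_bigl xpredT) => [|pq]; last exact: mem_set.
rewrite big_map big_filter [LHS]big_mkcond /=.
rewrite -[RHS](big_mkord xpredT (fun q => Em a (N + q%:Z) (Ep a q _))).
rewrite /index_iota subn0; apply: eq_bigr => q _.
case: ifP => [Nq0|/negbT]; last first.
  by rewrite -ltNge => Nq0; case: (Em_exp a) => EN _ _; case: (N + q%:Z) Nq0.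
apply: etrans (vop_term_mon a n (absz (N + q%:Z)) q s d) _.
rewrite gez0_abs // ifT //.
have -> : (absz (N + q%:Z))%:R = (N + q%:Z)%:~R :> K by rewrite pmulrn gez0_abs.
by apply/eqP; rewrite rmorphD /= -eN -pmulrn; ring.
Qed.

Lemma vop_mon_eq0 a n s d :
  (forall N : int, - n - 1 - frm a d <> N%:~R) -> vertex_op a n (mon s (vac d)) = 0.
Proof.
move=> noN; apply: fsbig1 => -[p q] _; apply: etrans (vop_term_mon a n p q s d) _.
case: eqP => // e; case: (noN (p%:Z - q%:Z)).
by rewrite e rmorphB /= -!pmulrn; ring.
Qed.

Lemma sum_bound s : \sum_(p <- s) p < (absz (\sum_(p <- s) p)).+1%:Z.
Proof. by rewrite -addn1 PoszD ltzD1 ler_norm. Qed.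

Lemma vop_linear a n : linear (vertex_op a n).
Proof.
apply: (fsum_linear (G := vop_term a n)); apply: mon_span => [|s d].
  exact: finitely_supported_subspace.
have [[N eN]|noN] := pselect (exists N : int, - n - 1 - frm a d = N%:~R).
  by eexists; apply: vop_support eN (sum_bound s).
exists [::] => -[p q] _; rewrite vop_term_mon.
case: (frm a d =P _) => [e|]; last by rewrite eqxx.
case: noN; exists (p%:Z - q%:Z).
by rewrite e rmorphB /= -!pmulrn; ring.
Qed.

HB.instance Definition _ a n :=
  GRing.isLinear.Build K W W *:%R (vertex_op a n) (vop_linear a n).

(** ** The cyclic modules *)

(** In degree [gamma + k beta] this is the space of polynomials of degree at most
    [k] in the complete symmetric functions [h_1, h_2, ...], as [h_0 = 1]. *)
Definition WLspan gamma w := forall P, subspace P ->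
  (forall s, P (mon s (vac (gamma + beta *+ size s)))) -> P w.

Lemma WLspan_subspace gamma : subspace (WLspan gamma).
Proof.
split=> [P [] //|c u v Xu Xv P sP Pmon].
by case: (sP) => _; apply; [apply: Xu | apply: Xv].
Qed.

Lemma WLspan_mon gamma s d : d = gamma + beta *+ size s ->
  WLspan gamma (mon s (vac d)).
Proof. by move=> -> P _; apply. Qed.

Lemma WLspan_ind gamma P w : subspace P ->
  (forall s, P (mon s (vac (gamma + beta *+ size s)))) -> WLspan gamma w -> P w.
Proof. by move=> sP Pmon; apply. Qed.

Lemma WLspan_vop gamma n w : WLspan gamma w -> WLspan gamma (vertex_op beta n w).
Proof.
apply: (WLspan_ind (P := fun w => WLspan gamma (vertex_op beta n w))) => [|s].
  by apply: subspace_preim; apply: WLspan_subspace.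
set d := gamma + _.
have [[N eN]|noN] := pselect (exists N : int, - n - 1 - frm beta d = N%:~R).
  rewrite (vop_mon eN (sum_bound s)); apply: subspace_sum => [|q _].
    exact: WLspan_subspace.
  apply: (Ep_mon _ (P := fun w => WLspan gamma (Em beta (N + q%:Z) w))) => [|s' ss' _].
    by apply: subspace_preim; apply: WLspan_subspace.
  apply: (@WLspan_mon gamma (N + q%:Z :: s')).
  by rewrite /= ss' mulrS addrCA.
rewrite vop_mon_eq0 => [|N eN]; last by apply: noN; exists N.
by case: (WLspan_subspace gamma).
Qed.

(** A monomial with [k + 1] factors is obtained from those with [k] factors: the
    creation half of the right mode of [e^beta] adds the missing factor, up to
    terms dealt with in [hmon_generated]. *)
Lemma WLspan_minimal gamma P w : subspace P ->
  (forall n w, P w -> P (vertex_op beta n w)) -> P (vac gamma) -> WLspan gamma w -> P w.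
Proof.
move=> sP Pvop Pvac; apply: WLspan_ind => // s.
have [k] := ubnP (size s); elim: k => // k IH in s *; rewrite ltnS => sk.
case: s sk => [|n s] /= sk; first by rewrite mulr0n addr0.
pose y l : {linear W -> W} := heis beta (- l%:Z).
pose x l : {linear W -> W} := heis beta l%:Z.
pose d := gamma + beta *+ (size s).+1.
apply: (hmon_generated (y := y) (x := x) (Em_exp beta) (heis_annih beta)
  (Ep_exp beta) (v0 := vac d) _ (d := size s)) => // [l|{}s' {}n ss'].
  exact: heis_vac.
exists (absz (\sum_(p <- s') p)).
pose d' := gamma + beta *+ size s'.
have -> : d = beta + d' by rewrite /d /d' ss' mulrS addrCA.
have eN : - (- n%:~R - 1 - frm beta d') - 1 - frm beta d' = n%:~R by ring.
rewrite -(vop_mon eN (sum_bound s')); apply: Pvop; apply: IH.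
by rewrite ss'.
Qed.

Lemma WLspan_sub gamma w : WLspan (gamma + beta) w -> WLspan gamma w.
Proof.
apply: WLspan_ind => [|s]; first exact: WLspan_subspace.
have [_ E0 _] := Em_exp beta.
rewrite -[mon s _]E0; apply: (@WLspan_mon gamma (0 :: s)).
by rewrite /= mulrS addrA.
Qed.

(** ** The intertwining operator *)

Lemma beta_mulz_inj gamma (r r' : int) :
  gamma + beta *~ r = gamma + beta *~ r' -> r = r'.
Proof.
move=> /addrI/eqP; rewrite -subr_eq0 -mulrzBr -scaler_int scaler_eq0.
by rewrite (negPf beta_neq0) orbF intr_eq0 subr_eq0 => /eqP.
Qed.

Lemma twist_support gamma s d : exists r,
  supported_in [set: int]%classic
   (fun r => ((-1) ^ r \*: fproj (gamma + beta *~ r)) (mon s (vac d))) r.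
Proof.
have [[r0 ->]|nor] := pselect (exists r, d = gamma + beta *~ r).
  exists [:: r0] => r _; rewrite /= fproj_mon inE.
  case: (_ =P gamma + beta *~ r) => [/beta_mulz_inj ->|_]; first by rewrite eqxx.
  by rewrite scaler0 eqxx.
exists [::] => r _; rewrite /= fproj_mon.
case: (d =P _) => [e|_]; first by case: nor; exists r.
by rewrite scaler0 eqxx.
Qed.

Lemma twist_linear gamma : linear (twist gamma).
Proof.
apply: (fsum_linear (G := fun r : int => (-1) ^ r \*: fproj (gamma + beta *~ r))).
apply: mon_span => [|s d]; first exact: finitely_supported_subspace.
exact: twist_support.
Qed.

HB.instance Definition _ gamma :=
  GRing.isLinear.Build K W W *:%R (twist gamma) (twist_linear gamma).

Lemma twist_mon gamma s (k : nat) :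
  twist gamma (mon s (vac (gamma + beta *+ k))) =
  (-1) ^+ k *: mon s (vac (gamma + beta *+ k)).
Proof.
rewrite /twist (fsum_seq (r := [:: k%:Z])) => [||r _] //.
  rewrite big_mkcond big_seq1 ifT; last exact: mem_set.
  by rewrite fproj_mon -pmulrn eqxx.
rewrite fproj_mon pmulrn inE.
case: (_ =P gamma + beta *~ r) => [/beta_mulz_inj ->|_]; first by rewrite eqxx.
by rewrite scaler0 eqxx.
Qed.

Definition intertwiner gamma : {linear W -> W} :=
  vertex_op bo (- frm bo gamma - 1) \o twist gamma.

(** On [e^(gamma + k beta)] the relevant mode of [e^bo] is the sum of the
    [Em bo (q - k) \o Ep bo q].  Here [Em bo (q - k)] vanishes for [q < k], and
    [Ep bo q] vanishes for [q > k] on monomials of length [k].  There remains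
    [Ep bo k], whose sign [(-1)^k] is the one of the twist. *)
Lemma intertwiner_mon gamma s d : d = gamma + beta *+ size s ->
  intertwiner gamma (mon s (vac d)) = mon [seq p - 1 | p <- s] (vac (bo + d)).
Proof.
move=> ->; set k := size s; rewrite /intertwiner /= twist_mon linearZ /=.
have eN : - (- frm bo gamma - 1) - 1 - frm bo (gamma + beta *+ k) = (- k%:Z)%:~R.
  have -> : frm bo (gamma + beta *+ k) = frm bo gamma + k%:R.
    elim: k => [|k IH]; first by rewrite mulr0n addr0 addr0.
    by rewrite mulrSr addrA frmD IH frm_bo_beta -natr1 addrA.
  by rewrite rmorphN /= -pmulrn; ring.
pose Q := (k + absz (\sum_(p <- s) p)).+1.
have sQ : \sum_(p <- s) p < Q%:Z.
  by apply: lt_le_trans (sum_bound s) _; rewrite lez_nat ltnS leq_addl.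
have kQ : (k < Q)%N by rewrite ltnS leq_addr.
have [EN E0 _] := Em_exp bo.
rewrite (vop_mon eN sQ) (bigD1 (Ordinal kQ)) //= big1 ?addr0 => [|q qk].
  rewrite addNr E0 Ep_bo_mon // eqxx scalerA -exprD addnn -mul2n exprM.
  by rewrite expr2 mulrNN mulr1 expr1n scale1r.
have [kq|qk'] := leqP k q.
  by rewrite Ep_bo_mon // ifF ?linear0 //; apply: negbTE.
have : - k%:Z + q%:Z < 0 by rewrite addrC subr_lt0 ltz_nat.
by case: (_ + _) => // j _; apply: EN.
Qed.

Lemma WLspan_intertwiner gamma w :
  WLspan gamma w -> WLspan (gamma + bo) (intertwiner gamma w).
Proof.
apply: (WLspan_ind (P := fun w => WLspan (gamma + bo) (intertwiner gamma w))).
  by apply: subspace_preim; apply: WLspan_subspace.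
move=> s; rewrite intertwiner_mon //; apply: WLspan_mon.
by rewrite size_map addrA [bo + _]addrC.
Qed.

(** On the span of the monomials of length [k], the intertwiner is, up to a sign and
    the shift of the weight, the annihilation operator [Ep bo k], so it commutes with the annihilation part
    of [vertex_op beta n]; on the creation part it shifts the index by one, which is
    accounted for by [frm beta bo = 1]. *)
Lemma intertwiner_vop gamma n w : WLspan gamma w ->
  intertwiner gamma (vertex_op beta n w) = vertex_op beta n (intertwiner gamma w).
Proof.
apply: (WLspan_ind (P := fun w =>
  intertwiner gamma (vertex_op beta n w) = vertex_op beta n (intertwiner gamma w))).
  exact: (subspace_eq (intertwiner gamma \o vertex_op beta n)
                      (vertex_op beta n \o intertwiner gamma)).
move=> s; set k := size s; set d := gamma + beta *+ k.
rewrite intertwiner_mon // -/d.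
have frm_d : frm beta (bo + d) = frm beta d + 1.
  by rewrite addrC frmD frm_beta_bo.
have [[N eN]|noN] := pselect (exists N : int, - n - 1 - frm beta d = N%:~R);
  last first.
  rewrite !vop_mon_eq0 ?linear0 // => N eN; apply: noN; last by exists N.
  exists (N + 1); rewrite rmorphD /= -eN frm_d; ring.
have eN1 : - n - 1 - frm beta (bo + d) = (N - 1)%:~R.
  by rewrite rmorphB /= -eN frm_d; ring.
pose s1 := [seq p - 1 | p <- s].
pose Q := maxn (absz (\sum_(p <- s) p)).+1 (absz (\sum_(p <- s1) p)).+1.
have sQ : \sum_(p <- s) p < Q%:Z.
  by apply: lt_le_trans (sum_bound s) _; rewrite lez_nat leq_maxl.
have s1Q : \sum_(p <- s1) p < Q%:Z.
  by apply: lt_le_trans (sum_bound s1) _; rewrite lez_nat leq_maxr.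
rewrite (vop_mon eN sQ) (vop_mon eN1 s1Q) linear_sum; apply: eq_bigr => q _.
pose lower : {linear W -> W} := (-1) ^+ k \*: (Ep bo k \o fshift bo).
have lower_mon s' d' : size s' = k ->
    lower (mon s' (vac d')) = mon [seq p - 1 | p <- s'] (vac (bo + d')).
  move=> ss'; rewrite /lower /= fshift_mon Ep_bo_mon ss' // eqxx scalerA.
  by rewrite -exprD addnn -mul2n exprM expr2 mulrNN mulr1 expr1n scale1r.
transitivity (Em beta (N - 1 + q%:Z)
    (lower (Ep beta q (mon s (vac (beta + d)))))).
  apply: (Ep_mon _ (P := fun w => intertwiner gamma (Em beta (N + q%:Z) w) =
    Em beta (N - 1 + q%:Z) (lower w))) => [|s' ss' _].
    exact: (subspace_eq (intertwiner gamma \o Em beta (N + q%:Z))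
                        (Em beta (N - 1 + q%:Z) \o lower)).
  rewrite lower_mon //.
  apply: etrans (intertwiner_mon (s := N + q%:Z :: s') _) _.
    by rewrite /= ss' mulrS addrCA.
  by rewrite /= [N - 1 + _]addrAC.
congr (Em _ _ _); rewrite /lower /= fshift_Ep Ep_Ep -linearZ /=.
by rewrite -[_ *: _]/(lower (mon s _)) lower_mon // addrCA.
Qed.

Lemma intertwiner_surj gamma w : WLspan (gamma + bo) w ->
  exists2 u, WLspan gamma u & intertwiner gamma u = w.
Proof.
apply: (WLspan_ind (P := fun w =>
  exists2 u, WLspan gamma u & intertwiner gamma u = w)).
  split=> [|c _ _ [u Xu <-] [v Xv <-]].
    by exists 0; rewrite ?linear0 //; case: (WLspan_subspace gamma).
  exists (c *: u + v); last exact: linearP.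
  by case: (WLspan_subspace gamma) => _; apply.
move=> s; pose s1 := [seq p + 1 | p <- s].
exists (mon s1 (vac (gamma + beta *+ size s1))); first exact: WLspan_mon.
rewrite intertwiner_mon // size_map addrA [bo + _]addrC -map_comp; congr mon.
by rewrite map_id_in // => p _ /=; rewrite addrK.
Qed.

Lemma intertwiner_sub gamma w :
  WLspan (gamma + beta) w -> intertwiner gamma w = 0.
Proof.
apply: (WLspan_ind (P := fun w => intertwiner gamma w = 0)) => [|s].
  split=> [|c u v u0 v0]; first exact: linear0.
  by rewrite linearP u0 v0 scaler0 addr0.
have [EN E0 _] := Em_exp beta.
rewrite -[mon s _]E0; apply: etrans (intertwiner_mon (s := 0 :: s) _) _.
  by rewrite /= mulrS addrA.
exact: EN 0 _.
Qed.

(** ** Linear independence of the monomials *)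

Local Notation key := (L * {mset nat}%mset)%type.
Local Notation formal := {malg K[key]}.

(** A multiset [A] stands for the product of the [h_j], for [j] in [A], including
    the factors [h_0 = 1]: in this way its size is the degree in [beta]. *)
Definition grade gamma (k : key) := k.1 = gamma + beta *+ size k.2.

Definition key_mon (k : key) : W := mon [seq j%:Z | j <- k.2 : seq nat] (vac k.1).

Local Notation realize := (lext key_mon).

(** The intertwiner on formal monomials: the factor [h_0] becomes [h_(-1) = 0]. *)
Definition lower_key (k : key) : formal :=
  if 0%N \in k.2 then 0 else << (bo + k.1, seq_mset [seq j.-1 | j <- k.2 : seq nat]) >>.

Definition raise_key (k : key) : formal :=
  << (k.1 - bo, seq_mset [seq j.+1 | j <- k.2 : seq nat]) >>.

Definition drop0_key (k : key) : formal :=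
  if 0%N \in k.2 then << (k.1, (k.2 `\ 0%N)%mset) >> else 0.

Definition add0_key (k : key) : formal := << (k.1, (0%N +` k.2)%mset) >>.

Lemma lower_keyE d A : lower_key (d, A) = if 0%N \in A then 0 else
  << (bo + d, seq_mset [seq j.-1 | j <- A : seq nat]) >>.
Proof. by []. Qed.

Lemma raise_keyE d A :
  raise_key (d, A) = << (d - bo, seq_mset [seq j.+1 | j <- A : seq nat]) >>.
Proof. by []. Qed.

Lemma drop0_keyE d A :
  drop0_key (d, A) = if 0%N \in A then << (d, (A `\ 0%N)%mset) >> else 0.
Proof. by []. Qed.

Lemma add0_keyE d A : add0_key (d, A) = << (d, (0%N +` A)%mset) >>.
Proof. by []. Qed.

Local Opaque lower_key raise_key drop0_key add0_key seq_mset msetD msetB.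

Lemma key_monE d (A : {mset nat}%mset) s : perm_eq [seq j%:Z | j <- A : seq nat] s ->
  key_mon (d, A) = mon s (vac d).
Proof. exact: (hmon_perm Em_Em). Qed.

Lemma key_mon_lower gamma k : grade gamma k ->
  intertwiner gamma (key_mon k) = lext key_mon (lower_key k).
Proof.
case: k => d A gA; rewrite {1}/key_mon intertwiner_mon /=; last by rewrite size_map.
rewrite lower_keyE; case: ifP => [A0|/negbT A0].
  rewrite linear0; apply: (hmon_neg (Em_exp beta)).
  by apply/hasP; exists (-1) => //; apply/mapP; exists 0 => //; apply/mapP; exists 0%N.
rewrite lextU; apply/esym/key_monE.
apply: perm_trans (perm_map _ (perm_eq_seq_mset _)) _; rewrite -!map_comp.
have /eq_in_map -> // : {in (A : seq nat),
    Posz \o predn =1 (fun p : int => p - 1) \o Posz}.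
by move=> [|i] iA /=; [rewrite iA in A0 | rewrite -addn1 PoszD addrK].
Qed.

Lemma WLspan_realize gamma f : supp_in (grade gamma) f -> WLspan gamma (realize f).
Proof.
move=> fg; apply: (malg_ind (P := fun f => WLspan gamma (realize f))).
  have sX := WLspan_subspace gamma.
  split=> [|c u v Xu Xv]; first by rewrite linear0; exact: (subspace0 sX).
  by rewrite linearP; exact: (subspaceP c sX).
move=> [d A] /fg gA; rewrite lextU; apply: WLspan_mon.
by rewrite size_map.
Qed.

Lemma realize_surj gamma w : WLspan gamma w ->
  exists2 f, supp_in (grade gamma) f & realize f = w.
Proof.
have sD := @supp_in_subspace K _ (grade gamma).
apply: (WLspan_ind (P := fun w =>
  exists2 f, supp_in (grade gamma) f & realize f = w)) => [|s].
  split=> [|c _ _ [f fg <-] [f' fg' <-]].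
    by exists 0; [exact: (subspace0 sD) | exact: linear0].
  by exists (c *: f + f'); [exact: (subspaceP c sD) | exact: linearP].
have [sneg|spos] := boolP (has (< 0) s).
  exists 0; first exact: (subspace0 sD).
  by rewrite (hmon_neg (Em_exp beta)) //; apply: linear0.
pose A : {mset nat}%mset := seq_mset [seq absz p | p <- s].
have pA : perm_eq A [seq absz p | p <- s] by apply: perm_eq_seq_mset.
exists << (gamma + beta *+ size s, A) >>.
  by apply: supp_in_key; rewrite /grade /= (perm_size pA) size_map.
rewrite lextU; apply: key_monE.
apply: perm_trans (perm_map _ pA) _; rewrite -map_comp map_id_in // => p ps /=.
by rewrite gez0_abs // leNgt; apply: (hasPn spos).
Qed.

Lemma raise_lower k : lext raise_key (lower_key k) =
  if 0%N \in k.2 then 0 else << k >>.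
Proof.
case: k => d A; rewrite lower_keyE /=.
have [_|A0] := boolP (0%N \in A); first exact: linear0.
rewrite lextU raise_keyE addrC addKr.
suff -> : seq_mset [seq j.+1 | j <- seq_mset [seq j.-1 | j <- A : seq nat] : seq nat]
  = A by [].
rewrite -[RHS]seq_mset_id; apply/eq_seq_msetP.
apply: perm_trans (perm_map _ (perm_eq_seq_mset _)) _; rewrite -map_comp.
rewrite map_id_in // => -[|i] //= iA; by rewrite iA in A0.
Qed.

(** On the monomials without a factor [h_0], [lower_key] is inverted by
    [raise_key]; on the others, [drop0_key] is inverted by [add0_key]. *)
Lemma lower_eq0 f : lext lower_key f = 0 ->
  f = lext add0_key (lext drop0_key f).
Proof.
apply: (lext_decomp (r := raise_key)) => -[d A].
apply: etrans (congr1 (+%R (lext add0_key (drop0_key (d, A)))) (raise_lower (d, A))) _.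
rewrite drop0_keyE /=; have [A0|_] := boolP (0%N \in (A : {mset nat}%mset)).
  by rewrite lextU add0_keyE addr0 msetB1K.
by rewrite (linear0 (lext add0_key)) add0r.
Qed.

Lemma size_mset_perm (A : {mset nat}%mset) (l : seq nat) :
  seq_mset l = A -> size A = size l.
Proof. by move=> <-; apply: perm_size; apply: perm_eq_seq_mset. Qed.

Lemma size_mset_add0 (A : {mset nat}%mset) : size (0%N +` A)%mset = (size A).+1.
Proof.
by rewrite (size_mset_perm (l := 0%N :: A)) // mset_cons seq_mset_id.
Qed.

Lemma key_mon_add0 d (A : {mset nat}%mset) :
  key_mon (d, (0%N +` A)%mset) = key_mon (d, A).
Proof.
have [_ E0 _] := Em_exp beta.
have /(perm_map Posz)/key_monE -> : perm_eq (0%N +` A)%mset (0%N :: A).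
  by apply/eq_seq_msetP; rewrite mset_cons !seq_mset_id.
by rewrite /= E0.
Qed.

Lemma realize_add0 f : realize (lext add0_key f) = realize f.
Proof.
apply: (linear_eq_supp (f1 := realize \o lext add0_key) (f2 := realize)
  (D := xpredT)) => // -[d A] _.
apply: etrans (congr1 realize (etrans (lextU add0_key (d, A)) (add0_keyE d A))) _.
apply: etrans (lextU key_mon _) (etrans _ (esym (lextU key_mon _))).
exact: key_mon_add0.
Qed.

Lemma realize_lower gamma f : supp_in (grade gamma) f ->
  intertwiner gamma (realize f) = realize (lext lower_key f).
Proof.
move=> fg; apply: (linear_eq_supp (f1 := intertwiner gamma \o realize)
  (f2 := realize \o lext lower_key) fg) => k gk /=.
apply: etrans (congr1 (intertwiner gamma) (lextU key_mon k)) _.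
apply: etrans (key_mon_lower gk) _.
exact: esym (congr1 realize (lextU lower_key k)).
Qed.

Let bounded gamma (l b : nat) (k : key) :=
  [/\ grade gamma k, (size k.2 <= l)%N & forall j : nat, j \in k.2 -> (j < b)%N].

Lemma lower_bounded gamma l b k : bounded gamma l b k ->
  supp_in (bounded (gamma + bo) l b.-1) (lower_key k).
Proof.
case: k => d A []; rewrite /grade /= => gA sA bA; rewrite lower_keyE.
case: ifP => [_|/negbT A0].
  exact: (subspace0 (@supp_in_subspace K _ _)).
have pA := perm_eq_seq_mset [seq j.-1 | j <- A : seq nat].
apply: supp_in_key; split; rewrite /grade /=.
- by rewrite (perm_size pA) size_map gA addrA [bo + _]addrC.
- by rewrite (perm_size pA) size_map.
move=> j; rewrite (perm_mem pA) => /mapP[[|i] iA -> /=]; first by rewrite iA in A0.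
by have := bA _ iA; case: (b).
Qed.

Lemma drop0_bounded gamma l b k : bounded gamma l.+1 b k ->
  supp_in (bounded (gamma + beta) l b) (drop0_key k).
Proof.
case: k => d A []; rewrite /grade /= => gA sA bA; rewrite drop0_keyE.
case: ifP => [A0|_]; last first.
  exact: (subspace0 (@supp_in_subspace K _ _)).
have eA : size A = (size (A `\ 0%N)%mset).+1 by rewrite -size_mset_add0 msetB1K.
apply: supp_in_key; split; rewrite /grade /=.
- by rewrite -addrA -mulrS -eA.
- by rewrite -ltnS -eA.
by move=> j; rewrite in_msetB1 => /andP[_ /bA].
Qed.

(** Applying the intertwiner to a relation lowers [b], so the relation only
    involves monomials with a factor [h_0]; deleting this factor does not change
    the values of the monomials, and lowers [l]. *)
Lemma realize_inj_bounded l b gamma f :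
  supp_in (bounded gamma l b) f -> realize f = 0 -> f = 0.
Proof.
have base delta g : supp_in (fun k => k = (delta, mset0)) g -> realize g = 0 -> g = 0.
  move=> g0; apply: lext_supp1_inj g0 _.
  by rewrite /key_mon /= enum_mset0; apply: vac_neq0.
elim: l b gamma f => [|l IHl] b gamma f.
  move=> fD; apply: base => -[d A] /fD[]; rewrite /grade /= => gA.
  rewrite leqn0 => /eqP A0 _.
  by rewrite gA A0 mulr0n addr0; move/eqP: A0; rewrite size_mset_eq0 => /eqP ->.
elim: b gamma f => [|b IHb] gamma f fD.
  apply: base => -[d A] /fD[]; rewrite /grade /= => gA _ A0.
  have A00 : A = mset0.
    by case: (mset_0Vmem (A : {mset nat}%mset)) => [//|[j /A0]].
  by rewrite gA A00 size_mset0 mulr0n addr0.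
move=> f0; have lf0 : lext lower_key f = 0.
  apply: IHb; first by apply: lext_supp fD _ => k; apply: lower_bounded.
  rewrite -(realize_lower (gamma := gamma)) ?f0 ?linear0 // => k /fD[]//.
have := lower_eq0 lf0.
have -> : lext drop0_key f = 0; last by rewrite linear0.
apply: (IHl b.+1 (gamma + beta)); last by rewrite -realize_add0 -lower_eq0.
by apply: lext_supp fD _ => k; apply: drop0_bounded.
Qed.

Let max_index (k : key) : nat := \max_(j <- (k.2 : seq nat)) j.+1.

Lemma max_indexP (k : key) j : j \in k.2 -> (j < max_index k)%N.
Proof. by move=> jk; apply: (leq_bigmax_seq (F := fun j => j.+1) j). Qed.

Lemma grade_bounded gamma (k : key) : grade gamma k ->
  bounded gamma (size k.2).+1 (max_index k) k.
Proof. by move=> gk; split=> // j; apply: max_indexP. Qed.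

Lemma realize_inj gamma f : supp_in (grade gamma) f -> realize f = 0 -> f = 0.
Proof.
move=> fg; pose len (k : key) := size k.2.
apply: (realize_inj_bounded (l := \max_(k <- msupp f) len k)
  (b := \max_(k <- msupp f) max_index k) (gamma := gamma)) => k fk.
have kf : k \in msupp f by rewrite -mcoeff_neq0.
split; [exact: fg | exact: (leq_bigmax_seq (F := len) k) | move=> j jk].
exact: leq_trans (max_indexP jk) (leq_bigmax_seq (F := max_index) k kf isT).
Qed.

Lemma intertwiner_ker gamma w : WLspan gamma w -> intertwiner gamma w = 0 ->
  WLspan (gamma + beta) w.
Proof.
move=> /realize_surj[f fg <-] f0.
have lf0 : lext lower_key f = 0.
  apply: (realize_inj (gamma := gamma + bo)); last by rewrite -(realize_lower fg).
  apply: lext_supp fg _ => k gk.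
  by have /lower_bounded lk := grade_bounded gk => k' /lk[].
rewrite (lower_eq0 lf0) realize_add0; apply: WLspan_realize.
apply: lext_supp fg _ => k gk.
by have /drop0_bounded dk := grade_bounded gk => k' /dk[].
Qed.

(** ** The exact sequence *)

Definition generated_module d (U : W -> Prop) :=
  [/\ subspace U, forall n w, U w -> U (vertex_op beta n w), U (vac d)
    & forall P, subspace P -> (forall n w, P w -> P (vertex_op beta n w)) ->
        P (vac d) -> forall w, U w -> P w].

Lemma generated_moduleE d U : generated_module d U -> forall w, U w <-> WLspan d w.
Proof.
move=> [sU Uvop Uvac Umin] w; split; last exact: WLspan_minimal.
apply: Umin; [exact: WLspan_subspace | exact: WLspan_vop |].
by apply: (@WLspan_mon d [::]); rewrite mulr0n addr0.
Qed.

Theorem generated_module_exact gamma (U1 U2 U3 : W -> Prop)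
    (T := vertex_op bo (- frm bo gamma - 1) \o twist gamma) :
  generated_module (gamma + beta) U1 -> generated_module gamma U2 ->
  generated_module (gamma + bo) U3 ->
  [/\ forall w, U2 w -> U3 (T w), linear T,
      forall n w, U2 w -> T (vertex_op beta n w) = vertex_op beta n (T w),
      forall w, U1 w <-> U2 w /\ T w = 0
    & forall w, U3 w -> exists2 u, U2 u & T u = w].
Proof.
move=> g1 g2 g3; have U1E := generated_moduleE g1.
have U2E := generated_moduleE g2; have U3E := generated_moduleE g3.
split=> [w /U2E Uw||n w /U2E Uw|w|w /U3E /intertwiner_surj[u /U2E Uu Tu]].
- by apply/U3E; apply: WLspan_intertwiner.
- exact: (linearP (intertwiner gamma)).
- exact: intertwiner_vop.
- split=> [/U1E Uw|[/U2E Uw Tw]]; last by apply/U1E; apply: intertwiner_ker.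
  by split; [apply/U2E; apply: WLspan_sub | apply: intertwiner_sub].
- by exists u.
Qed.

End FockModule.

(** * The Fock space of the Heisenberg algebra *)

Section Fock.
Context {R : realType} {h : vectType R[i]} (form : {symmetric h}).
Local Notation V := (fock R h).
Local Notation C := R[i]%C.
Implicit Types (a gamma delta : h) (v : V) (n : int).

Local Notation create gamma :=
  (fun k : nat => k%:R^-1 \*: heis form gamma (- k%:Z)).
Local Notation annih gamma :=
  (fun k : nat => (- k%:R^-1) \*: heis form gamma k%:Z).

Lemma Eminus_is_linear gamma p : linear (Eminus form gamma p).
Proof. exact: (@exp_linear C V (create gamma) (expow_coef (create gamma))). Qed.

HB.instance Definition _ gamma p :=
  GRing.isLinear.Build C V V *:%R (Eminus form gamma p) (Eminus_is_linear gamma p).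

Lemma Eplus_is_linear gamma p : linear (Eplus form gamma p).
Proof. exact: (@exp_linear C V (annih gamma) (expow_coef (annih gamma))). Qed.

HB.instance Definition _ gamma p :=
  GRing.isLinear.Build C V V *:%R (Eplus form gamma p) (Eplus_is_linear gamma p).

HB.instance Definition _ gamma :=
  GRing.isLinear.Build C V V *:%R (fshift gamma) (linext_is_linear _).

HB.instance Definition _ gamma :=
  GRing.isLinear.Build C V V *:%R (fproj gamma) (linext_is_linear _).

(** [Eminus] and [Eplus] as linear maps, extended by zero to the negative
    indices. *)
Definition Em gamma n : {linear V -> V} :=
  if n is Posz p then Eminus form gamma p else \0.

Definition Ep gamma n : {linear V -> V} :=
  if n is Posz p then Eplus form gamma p else \0.

Lemma Em_comm gamma (f : {linear V -> V}) n v :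
  (forall (k : nat) v, (0 < k)%N ->
    f (heis form gamma (- k%:Z) v) = heis form gamma (- k%:Z) (f v)) ->
  f (Em gamma n v) = Em gamma n (f v).
Proof.
case: n => [p|j] fh; last exact: linear0.
apply: (@exp_comm C V (create gamma) (expow_coef (create gamma))) => // k w k0.
by rewrite /= linearZ /= fh.
Qed.

Lemma Ep_comm gamma (f : {linear V -> V}) n v :
  (forall (k : nat) v, (0 < k)%N ->
    f (heis form gamma k%:Z v) = heis form gamma k%:Z (f v)) ->
  f (Ep gamma n v) = Ep gamma n (f v).
Proof.
case: n => [p|j] fh; last exact: linear0.
apply: (@exp_comm C V (annih gamma) (expow_coef (annih gamma))) => // k w k0.
by rewrite /= linearZ /= fh.
Qed.

Lemma fshiftU gamma d A : fshift gamma << (d, A) >> = << (gamma + d, A) >> :> V.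
Proof. exact: linextU. Qed.

Lemma fprojU delta d A :
  fproj delta << (d, A) >> = (if d == delta then << (d, A) >> else 0) :> V.
Proof. exact: linextU. Qed.

Local Opaque heis fshift fproj.

(** For [n != 0] the operator [heis form a n] acts on the multiset of a basis
    vector, with a coefficient that does not depend on its weight. *)
Lemma fshift_heis gamma a n v : n != 0 ->
  fshift gamma (heis form a n v) = heis form a n (fshift gamma v).
Proof.
move=> n0; apply: (linear_eq_supp (f1 := fshift gamma \o heis form a n)
  (f2 := heis form a n \o fshift gamma) (D := fun=> True)) => // -[d A] _.
have H (c : C) (B : {mset nat}%mset) : heis form a n << (d, A) >> = c *: << (d, B) >> ->
    heis form a n << (gamma + d, A) >> = c *: << (gamma + d, B) >> ->
    fshift gamma (heis form a n << (d, A) >>) =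
    heis form a n (fshift gamma << (d, A) >>).
  move=> e e'; rewrite (fshiftU gamma d A) e e'.
  exact: etrans (linearZ_LR (fshift gamma) c _) (congr1 _ (fshiftU gamma d B)).
case: n n0 H => [[|j]|j] n0 H; first by case/negP: n0.
- exact: (H _ _ (heisPU form a j d A) (heisPU form a j (gamma + d) A)).
- exact: (H _ _ (heisNU form a j d A) (heisNU form a j (gamma + d) A)).
Qed.

Lemma fproj_heis delta a n v :
  fproj delta (heis form a n v) = heis form a n (fproj delta v).
Proof.
apply: (linear_eq_supp (f1 := fproj delta \o heis form a n)
  (f2 := heis form a n \o fproj delta) (D := fun=> True)) => // -[d A] _ /=.
have H (c : C) (B : {mset nat}%mset) : heis form a n << (d, A) >> = c *: << (d, B) >> ->
    fproj delta (heis form a n << (d, A) >>) =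
    heis form a n (fproj delta << (d, A) >>).
  move=> e; rewrite (fprojU delta d A) e (linearZ_LR (fproj delta) c).
  apply: etrans (congr1 ( *:%R c) (fprojU delta d B)) _.
  case: (d == delta); first exact: esym e.
  exact: etrans (scaler0 _ c) (esym (linear0 (heis form a n))).
case: n H => [[|j]|j] H.
- exact: (H _ _ (heis0U form a d A)).
- exact: (H _ _ (heisPU form a j d A)).
- exact: (H _ _ (heisNU form a j d A)).
Qed.

Section OneDimensional.
Hypothesis dim : \dim {:h} = 1%N.

Lemma heis_heis a a' n k v : heis form a n (heis form a' k v) =
  heis form a' k (heis form a n v) +
    (if n + k == 0 then n%:~R * form a a' else 0) *: v.
Proof. exact: eq_addl_of_sub (heisC form a a' n k v dim). Qed.

Lemma Em_exp gamma : exp_family (fun k v => heis form gamma (- k%:Z) v) (Em gamma).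
Proof.
apply: (@exp_family_exp C V (create gamma) (expow_coef (create gamma))
  _ (fun p v => erefl) (fun i p v => erefl) _ _ _
  (fun j v => erefl) (fun p v => erefl)) => [k l v|k v k0].
  apply: (@scale_comm C V (heis form gamma (- k%:Z)) (heis form gamma (- l%:Z))) => w.
  by apply: (heis_comm heis_heis); rewrite -opprD !oppr_eq0; case: (k).
exact: scale_natK.
Qed.

Lemma Ep_exp gamma : exp_family (fun k v => - heis form gamma k%:Z v) (Ep gamma).
Proof.
apply: (@exp_family_exp C V (annih gamma) (expow_coef (annih gamma))
  _ (fun p v => erefl) (fun i p v => erefl) _ _ _
  (fun j v => erefl) (fun p v => erefl)) => [k l v|k v k0].
  apply: (@scale_comm C V (heis form gamma k%:Z) (heis form gamma l%:Z)) => w.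
  by apply: (heis_comm heis_heis); case: (k).
exact: scale_natNK.
Qed.

(** The basis vectors of the Fock space are obtained from the vacuum vectors by the
    operators [heis form beta (- l)], since [beta] spans [h]. *)
Lemma fock_generated beta (P : V -> Prop) : beta != 0 -> subspace P ->
  (forall d, P (vac d)) ->
  (forall (l : nat) v, (0 < l)%N -> P v -> P (heis form beta (- l%:Z) v)) ->
  forall v, P v.
Proof.
move=> beta0 sP Pvac Pheis v; apply: malg_ind => // -[d A] _.
have c0 : coord [tuple hbasis h] ord0 beta != 0.
  by apply: contraNneq beta0 => c0; rewrite (coord_hbasis dim beta) c0 scale0r.
suff H (l : seq nat) : P << (d, seq_mset l) >>.
  by rewrite -[A]seq_mset_id; apply: H.
elim: l => [|j l IH].
  have -> : seq_mset [::] = mset0 :> {mset nat}%mset.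
    by apply/msetP => i; rewrite mset_seqE mset0E.
  exact: Pvac.
rewrite mset_cons; apply: (subspaceVZ sP c0).
have e : heis form beta (- j.+1%:Z) << (d, seq_mset l) >> =
    coord [tuple hbasis h] ord0 beta *: << (d, (j +` seq_mset l)%mset) >>.
  exact: heisNU.
have Pj := Pheis j.+1 _ isT IH; rewrite e in Pj; exact: Pj.
Qed.

End OneDimensional.

End Fock.

(** * Exactness *)

Section Exactness.
Context {R : realType} {h : vectType R[i]} (form : {symmetric h}).
Local Notation V := (fock R h).
Local Notation C := R[i]%C.
Hypothesis dim : \dim {:h} = 1%N.
Variables (beta bo : h).
Hypothesis beta_neq0 : beta != 0.
Hypothesis form_beta_bo : form beta bo = 1.

Lemma WL_moduleE (U : set V) : WL_module form beta U <->
  subspace U /\ forall n v, U v -> U (vop form beta n v).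
Proof.
split=> -[] [U0 UD] Uvop; split=> //; split.
- exact: set_mem.
- by move=> c u v Uu Uv; apply: set_mem; apply: UD; apply: mem_set.
- exact: mem_set.
- by move=> c u v /set_mem Uu /set_mem Uv; apply: mem_set; apply: UD.
Qed.

Lemma WL_is_module gamma : WL_module form beta (WL form beta gamma).
Proof.
apply/WL_moduleE; split; first split.
- by move=> U [/WL_moduleE[[]]].
- move=> c u v Wu Wv U UP; have [/WL_moduleE[sU _] _] := UP.
  by apply: (subspaceP c sU); [apply: Wu | apply: Wv].
- move=> n v Wv U UP; have [/WL_moduleE[_ Uvop] _] := UP.
  by apply: Uvop; apply: Wv.
Qed.

Local Notation generated :=
  (generated_module (fun a d => form a d) (@vac R h) (@fshift R h) (@fproj R h)
    (Em form) (Ep form) beta).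

Lemma WL_generated gamma : generated gamma (WL form beta gamma).
Proof.
have /WL_moduleE[sW Wvop] := WL_is_module gamma.
split=> //; first by move=> U [_]; apply.
move=> P sP Pvop Pvac w; apply; split; last by move=> _ ->.
by apply/WL_moduleE; split.
Qed.

Lemma WL_exact gamma : WL_short_exact form beta
  (WL form beta (gamma + beta)) (WL form beta gamma) (WL form beta (gamma + bo))
  id (vop form bo (- form bo gamma - 1) \o sign_twist beta gamma).
Proof.
have frmD a d d' : form a (d + d') = form a d + form a d' by apply: linearD.
have form_bo_beta : form bo beta = 1 by rewrite Defs.formC.
have heis_vac a (k : nat) d : (0 < k)%N -> heis form a k%:Z (vac d) = 0.
  by case: k => // k _; apply: heisP_vac.
have vac_neq0 (d : h) : vac d != 0 :> V by rewrite monalgU_eq0 oner_neq0.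
have fshift_vac (a d : h) : fshift a (vac d) = vac (a + d) :> V.
  exact: fshiftU.
have fproj_vac (d d' : h) :
    fproj d (vac d') = (if d' == d then vac d' else 0) :> V.
  exact: fprojU.
have [T_mod T_lin T_vop T_ker T_surj] := generated_module_exact
  frmD form_beta_bo form_bo_beta beta_neq0 (heis_heis form dim) heis_vac vac_neq0
  (@fshift_heis R h form) fshift_vac (@fproj_heis R h form) fproj_vac
  (fun P => @fock_generated R h form dim beta P beta_neq0)
  (Em_exp form dim) (Ep_exp form dim) (@Em_comm R h form) (@Ep_comm R h form)
  (WL_generated (gamma + beta)) (WL_generated gamma) (WL_generated (gamma + bo)).
split; first by split; apply: WL_is_module.
- split; split=> //; first by move=> w /T_ker[].
  by move=> c u v _ _; apply: T_lin.
- by move=> u v _ _.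
- apply/seteqP; split=> [_ [w /T_ker Uw <-]|w /T_ker Uw] //.
  by exists w.
apply/seteqP; split=> [_ [w /T_mod Uw <-]|w /T_surj[u Uu Tu]] //.
by exists u.
Qed.

End Exactness.

Theorem mainTheorem4 (R : realType) (h : vectType R[i]) (form : {symmetric h})
    (beta : h) (g m : R[i]) :
  \dim {:h} = 1%N -> nondegenerate form -> g != 0 -> form beta beta = g ->
  let betao := g^-1 *: beta in
  WL_short_exact form beta
    (WL form beta ((m + g) *: betao))
    (WL form beta (m *: betao))
    (WL form beta ((m + 1) *: betao))
    id
    (vop form betao (- (g^-1 * m) - 1) \o sign_twist beta (m *: betao)).
Proof.
move=> dim _ g0 form_beta betao.
have beta0 : beta != 0.
  by apply: contraNneq g0 => beta0; rewrite -form_beta beta0 linear0.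
have beta_bo : form beta betao = 1 by rewrite linearZ /= form_beta mulVf.
have bo_bo : form betao (m *: betao) = g^-1 * m.
  by rewrite !linearZ /= Defs.formC beta_bo mulr1 mulrC.
have := WL_exact dim beta0 beta_bo (m *: betao).
have g_betao : g *: betao = beta by rewrite scalerA mulfV // scale1r.
by rewrite bo_bo !scalerDl g_betao scale1r.
Qed.
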